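(* Let $n\ge 2$ and let $X\subset\mathbb{R}^n$ be a polytope with $n_v\le n_f=3$ vertices contained in the set $X_v$. Run the Three-Vertex Algorithm (described in the context) with the oracle $\mathsf{D}(d)=\max_{v\in X}v^\top d$. If $n_v=1$, then the algorithm terminates after at most $2n-1$ oracle calls. If $n_v=2$, then the algorithm terminates after at most $5n-3$ oracle calls. If $n_v=3$, then the algorithm terminates after at most $5n-1$ oracle calls. In all cases, the algorithm terminates with $X_v=S_v$.
   Context: Polytopes are nonempty and compact; $X_v$ is the vertex set of $X$. The oracle $\mathsf{D}:\mathbb{R}^n\to\mathbb{R}$, $\mathsf{D}(d)=\max_{v\in X}v^\top d$, is the only access to $X$, apart from knowing that $X$ has at most $n_f=3$ vertices; an oracle call is one evaluation of $\mathsf{D}$. $\mathrm{e}_i$ is the $i$-th coordinate vector. For $2\le k\le n$, the projection of $X$ in $\mathbb{R}^k$ is the image of $X$ under projection onto the first $k$ coordinates, and $n_v^k$ denotes its number of vertices; $\mathbb{R}^k$ is identified with $\{x\in\mathbb{R}^n:x_j=0,\ j>k\}$. The support function of this projection at $d\in\mathbb{R}^k$ is $\mathsf{D}(d)$ with $d$ padded by zeros. Planar Algorithm (for a polytope $Y\subset\mathbb{R}^2$ with support oracle $\mathsf{D}_Y(\delta)=\max_{y\in Y}y^\top\delta$ and vertex bound $n_f$). For a polygon $P$, $P_v$ is its vertex set, $P_e=P\setminus(\mathrm{int}(P)\cup P_v)$, and $L(\delta)=\{y:y^\top\delta=\mathsf{D}_Y(\delta)\}$. Initialization: set $P=\bigcap_{\delta\in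 E}\{y:y^\top\delta\le\mathsf{D}_Y(\delta)\}$ with $E=\{\mathrm{e}_1,\mathrm{e}_2,-\mathrm{e}_1-\mathrm{e}_2\}$ (3 oracle calls). If $P$ is a singleton, set $S_v=P$ and terminate. Otherwise enumerate $P_v=\{p^1,p^2,p^3\}$ clockwise, and set $S_v=\emptyset$, $i=1$. While $P_v\ne S_v$ and $|S_v|<n_f$ (with $P=\mathrm{conv}(P_v)$, clockwise enumeration, indices modulo $|P_v|$): set $a=p^i$, $b=p^{i+1}$, $c=p^{i+2}$; choose $\delta$ with $\delta^\top a=\delta^\top c<\delta^\top b$; compute $\mathsf{D}_Y(\delta)$ (one oracle call). - If $\mathsf{D}_Y(\delta)=\delta^\top b$: add $b$ to $S_v$ and increase $i$ by 1. - If $\mathsf{D}_Y(\delta)=\delta^\top a$: add $a,c$ to $S_v$, remove $b$ from $P_v$, re-enumerate clockwise with $a$ keeping index $i$ and $c$ getting index $i+1$, and increase $i$ by 1. - Otherwise: let $\{b',c'\}=P_e\cap L(\delta)$, replace $P_v$ by $(P_v\setminus\{b\})\cup\{b',c'\}$, re-enumerate clockwise with $a$ keeping index $i$ and the new points getting indices $i+1,i+2$, and leave $i$ unchanged. Return $S_v$. Three-Vertex Algorithm. Initialization: apply the Planar Algorithm with $n_f=3$ to the projection of $X$ in $\mathbb{R}^2$ (each planar oracle call is one call of $\mathsf{D}$), obtaining its $n_v^2$ vertices, written $x^j=(x^j_1,x^j_2,0,\dots,0)\in\mathbb{R}^n$, $1\le j\le n_v^2$. For $k$ from $3$ to $n$: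 given $x^j=(x^j_1,\dots,x^j_{k-1},0,\dots,0)\in\mathbb{R}^n$, $1\le j\le n_v^{k-1}$ (the vertices of the projection in $\mathbb{R}^{k-1}$), call the oracle twice and set $\ell_k=-\mathsf{D}(-\mathrm{e}_k)$, $u_k=\mathsf{D}(\mathrm{e}_k)$. If $\ell_k=u_k$, set $n_v^k=n_v^{k-1}$ and reset $x^j_k\leftarrow\ell_k$ for each $1\le j\le n_v^k$. Otherwise $\ell_k<u_k$; apply the appropriate case. Case I ($n_v^{k-1}=1$): set $n_v^k=2$, $x^2=x^1$, and reset $x^1_k\leftarrow\ell_k$ and $x^2_k\leftarrow u_k$. Case II ($n_v^{k-1}=2$): the $n_v^k\le 3$ vertices of the projection in $\mathbb{R}^k$ lie in the two-dimensional plane containing $\{x^i+\ell_k\mathrm{e}_k,\ x^i+u_k\mathrm{e}_k: i=1,2\}$. Use a change of variables to reduce this to a problem in $\mathbb{R}^2$: the coordinates $(s,t)\mapsto x^1+s(x^2-x^1)+t\mathrm{e}_k$ identify the projection with a polytope $Y\subset\mathbb{R}^2$. An evaluation $\mathsf{D}_Y(\delta)$ costs one call: $\mathsf{D}_Y(\delta)=\mathsf{D}(d)-d^\top x^1$ for any $d$ with $d_j=0$ for $j>k$, $d_k=\delta_2$, $d^\top(x^2-x^1)=\delta_1$. Apply the Planar Algorithm to $Y$ with $n_f=3$, using the current state as its initialization: the initialization is replaced, at no further oracle cost, by the already known rectangle $P=[0,1]\times[\ell_k,u_k]$ (that is, $E=\{\pm\mathrm{e}_1,\pm\mathrm{e}_2\}$),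 with its 4 vertices enumerated clockwise, $S_v=\emptyset$, $i=1$. The vertices of $Y$ found, mapped back to $\mathbb{R}^k$, become the new $x^j$, $1\le j\le n_v^k$. Case III ($n_v^{k-1}=3$): set $n_v^k=3$. For $j=1,2,3$: choose $d\in\mathbb{R}^n$ so that $d^\top(x^j+\ell_k\mathrm{e}_k)=0$ and, for $i\in\{1,2,3\}$, $d^\top(x^i+u_k\mathrm{e}_k)=1$ if $i=j$ and $d^\top(x^i+u_k\mathrm{e}_k)=0$ if $i\ne j$; call the oracle and reset $x^j_k\leftarrow\ell_k+\mathsf{D}(d)(u_k-\ell_k)$. Return $S_v=\{x^j:1\le j\le n_v^n\}$.
   Formalization: In Case III the printed conditions on d are in general unsolvable; here they are imposed on d^T x − β for some offset β, D(d) is replaced by D(d) − β, d has zero coordinates after k, and x^i are the points given at the start of round k. *)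

(* Defs.v *)
From mathcomp Require Import all_boot all_order all_algebra finmap.
From mathcomp Require Import all_classical all_reals all_analysis.

Set Implicit Arguments.
Unset Strict Implicit.
Unset Printing Implicit Defensive.

Import Order.TTheory GRing.Theory Num.Theory.
Import numFieldNormedType.Exports.

Local Open Scope classical_set_scope.
Local Open Scope ring_scope.

(* MathComp-Analysis.  Points of R^n are row vectors 'rV[R]_n.  Coordinates
   are numbered from 1 in the algorithm (k below) and from 0 in 'I_n. *)

Definition dotp (R : realType) (n : nat) (u v : 'rV[R]_n) : R :=
  (u *m v^T) 0 0.

Definition conv_hull (R : realType) (n : nat) (s : seq 'rV[R]_n) :
    set 'rV[R]_n :=
  [set x | exists w : 'I_(size s) -> R,
     [/\ forall i, 0 <= w i, \sum_i w i = 1 & x = \sum_i w i *: s`_i]].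

Definition polytope (R : realType) (n : nat) (X : set 'rV[R]_n) : Prop :=
  exists2 s : seq 'rV[R]_n, s != [::] & X = conv_hull s.

Definition vertices (R : realType) (n : nat) (X : set 'rV[R]_n) :
    set 'rV[R]_n :=
  [set v | X v /\
     forall (x y : 'rV[R]_n) (t : R), X x -> X y -> 0 < t < 1 ->
       v = t *: x + (1 - t) *: y -> x = v /\ y = v].

Definition support_oracle (R : realType) (n : nat) (X : set 'rV[R]_n)
    (D : 'rV[R]_n -> R) : Prop :=
  forall d, (exists2 v, X v & dotp v d = D d) /\
            (forall v, X v -> dotp v d <= D d).

(* Executions of a nondeterministic program: [step c m c'] means that one step
   leads from c to c' with m oracle calls.  Every "choose" or "enumerate" of
   the algorithms is resolved arbitrarily by the relation. *)

Inductive exec (C : Type) (step : C -> nat -> C -> Prop) :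
    C -> nat -> C -> Prop :=
| exec_refl c : exec step c 0 c
| exec_step c1 c2 c3 m q :
    step c1 m c2 -> exec step c2 q c3 -> exec step c1 (m + q)%N c3.

Definition halted (C : Type) (step : C -> nat -> C -> Prop) (c : C) : Prop :=
  forall m c', ~ step c m c'.

Definition no_infinite_run (C : Type) (step : C -> nat -> C -> Prop) (c : C) :
    Prop :=
  Acc (fun c2 c1 => exists m, step c1 m c2) c.

Definition plane_e1 (R : realType) : 'rV[R]_2 := delta_mx 0 0.
Definition plane_e2 (R : realType) : 'rV[R]_2 := delta_mx 0 1.

Definition cross (R : realType) (u v : 'rV[R]_2) : R :=
  u 0 0 * v 0 1 - u 0 1 * v 0 0.

(* The list p is duplicate-free and enumerates clockwise the vertices of the
   polygon conv_hull p (strictly convex position). *)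
Definition clockwise (R : realType) (p : seq 'rV[R]_2) : Prop :=
  uniq p /\
  forall i j k : nat, (i < j)%N -> (j < k)%N -> (k < size p)%N ->
    cross (p`_j - p`_i) (p`_k - p`_i) < 0.

(* The i-th point of an enumeration, indices modulo its length. *)
Definition cyc (R : realType) (p : seq 'rV[R]_2) (i : nat) : 'rV[R]_2 :=
  p`_(i %% size p).

(* The algorithm's P_e. *)
Definition open_edges (R : realType) (p : seq 'rV[R]_2) : set 'rV[R]_2 :=
  conv_hull p `\` (interior (conv_hull p) `|` [set` p]).

Definition line (R : realType) (delta : 'rV[R]_2) (r : R) : set 'rV[R]_2 :=
  [set y | dotp y delta = r].

Definition init_directions (R : realType) : seq 'rV[R]_2 :=
  [:: plane_e1 R; plane_e2 R; - plane_e1 R - plane_e2 R].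

Definition outer_polygon (R : realType) (E : seq 'rV[R]_2)
    (r : 'rV[R]_2 -> R) : set 'rV[R]_2 :=
  [set y | {in E, forall delta, dotp y delta <= r delta}].

(* PLoop p S i: the head of the while loop, with p the enumeration of P_v,
   S the current S_v, and i the current index (enumerations start at 0). *)
Inductive planar_conf (R : realType) : Type :=
| PInit
| PLoop of seq 'rV[R]_2 & {fset 'rV[R]_2} & nat
| PDone of {fset 'rV[R]_2}.
Arguments PInit {R}.

Definition loop_cond (R : realType) (nf : nat) (p : seq 'rV[R]_2)
    (S : {fset 'rV[R]_2}) : Prop :=
  ~ (p =i S) /\ (#|` S| < nf)%N.

Definition cut_direction (R : realType) (p : seq 'rV[R]_2) (i : nat)
    (delta : 'rV[R]_2) : Prop :=
  dotp delta (cyc p i) = dotp delta (cyc p i.+2) /\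
  dotp delta (cyc p i) < dotp delta (cyc p i.+1).

(* [ask delta r] holds when r is a possible answer to the planar query delta;
   answering costs one oracle call.  It is a relation because in Case II below
   the query of D that implements delta is not unique. *)
Inductive planar_step (R : realType) (ask : 'rV[R]_2 -> R -> Prop)
    (nf : nat) : planar_conf R -> nat -> planar_conf R -> Prop :=
| PStartPoint (r : 'rV[R]_2 -> R) (y : 'rV[R]_2) :
    {in init_directions R, forall delta, ask delta (r delta)} ->
    outer_polygon (init_directions R) r = [set y] ->
    planar_step ask nf PInit 3 (PDone [fset y]%fset)
| PStartPolygon (r : 'rV[R]_2 -> R) (p : seq 'rV[R]_2) :
    {in init_directions R, forall delta, ask delta (r delta)} ->
    ~ (exists y, outer_polygon (init_directions R) r = [set y]) ->
    clockwise p ->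
    [set` p] = vertices (outer_polygon (init_directions R) r) ->
    planar_step ask nf PInit 3 (PLoop p fset0 0)
| PExit p S i :
    ~ loop_cond nf p S ->
    planar_step ask nf (PLoop p S i) 0 (PDone S)
| PKeep p S i delta r :
    loop_cond nf p S -> cut_direction p i delta -> ask delta r ->
    r = dotp delta (cyc p i.+1) ->
    planar_step ask nf (PLoop p S i) 1
      (PLoop p (cyc p i.+1 |` S)%fset i.+1)
| PRemove p S i delta r p' :
    loop_cond nf p S -> cut_direction p i delta -> ask delta r ->
    r = dotp delta (cyc p i) ->
    clockwise p' -> p' =i [seq y <- p | y != cyc p i.+1] ->
    cyc p' i = cyc p i -> cyc p' i.+1 = cyc p i.+2 ->
    planar_step ask nf (PLoop p S i) 1
      (PLoop p' (cyc p i |` (cyc p i.+2 |` S))%fset i.+1)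
| PCut p S i delta r b' c' p' :
    loop_cond nf p S -> cut_direction p i delta -> ask delta r ->
    r <> dotp delta (cyc p i.+1) -> r <> dotp delta (cyc p i) ->
    [set b'; c'] = open_edges p `&` line delta r ->
    clockwise p' -> p' =i [:: b', c' & [seq y <- p | y != cyc p i.+1]] ->
    cyc p' i = cyc p i ->
    [set cyc p' i.+1; cyc p' i.+2] = [set b'; c'] ->
    planar_step ask nf (PLoop p S i) 1 (PLoop p' S i).

Definition unit_vec (R : realType) (n k : nat) : 'rV[R]_n :=
  \row_(j < n) (j.+1 == k)%:R.

Definition set_coord (R : realType) (n k : nat) (v : R) (x : 'rV[R]_n) :
    'rV[R]_n :=
  \row_(j < n) if j.+1 == k then v else x 0 j.

(* d belongs to R^k, seen as a subspace of R^n. *)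
Definition in_first (R : realType) (n k : nat) (d : 'rV[R]_n) : Prop :=
  forall j : 'I_n, (k <= j)%N -> d 0 j = 0.

Definition pad2 (R : realType) (n : nat) (y : 'rV[R]_2) : 'rV[R]_n :=
  y 0 0 *: unit_vec R n 1 + y 0 1 *: unit_vec R n 2.

Definition ask_proj2 (R : realType) (n : nat) (D : 'rV[R]_n -> R)
    (delta : 'rV[R]_2) (r : R) : Prop :=
  r = D (pad2 n delta).

Definition ask_caseII (R : realType) (n : nat) (D : 'rV[R]_n -> R) (k : nat)
    (x1 x2 : 'rV[R]_n) (delta : 'rV[R]_2) (r : R) : Prop :=
  exists d : 'rV[R]_n,
    [/\ in_first k d,
        dotp d (unit_vec R n k) = delta 0 1,
        dotp d (x2 - x1) = delta 0 0
      & r = D d - dotp d x1].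

Definition caseII_point (R : realType) (n k : nat) (x1 x2 : 'rV[R]_n)
    (y : 'rV[R]_2) : 'rV[R]_n :=
  x1 + y 0 0 *: (x2 - x1) + y 0 1 *: unit_vec R n k.

Definition rectangle (R : realType) (l u : R) : set 'rV[R]_2 :=
  [set y | 0 <= y 0 0 <= 1 /\ l <= y 0 1 <= u].

Definition lower (R : realType) (n : nat) (D : 'rV[R]_n -> R) (k : nat) : R :=
  - D (- unit_vec R n k).
Definition upper (R : realType) (n : nat) (D : 'rV[R]_n -> R) (k : nat) : R :=
  D (unit_vec R n k).

(* The direction d chosen in Case III for the j-th vertex.  The conditions
   require the function x |-> d^T x - beta to be 0 at x^j + l e_k, 1 at
   x^j + u e_k and 0 at x^i + u e_k for i <> j.  A linear function (beta = 0)
   with these values need not exist: for k = 3 it already fails for x^1, x^2,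
   x^3 = (1,0), (0,1), (-1,-1), l = 0, u = 1.  The offset beta amounts to a
   translation of the origin, as does the term d^T x^1 in Case II; the choices
   with beta = 0 are among those allowed.  The points xs are those given at the
   head of the for loop (k-th coordinate 0), also after x^1, x^2 are reset. *)
Definition caseIII_direction (R : realType) (n k : nat) (l u : R)
    (xs : seq 'rV[R]_n) (j : nat) (d : 'rV[R]_n) (beta : R) : Prop :=
  [/\ in_first k d,
      dotp d (xs`_j + l *: unit_vec R n k) - beta = 0
    & forall i, (i < 3)%N ->
        dotp d (xs`_i + u *: unit_vec R n k) - beta = (i == j)%:R].

(* Init: inside the initial planar computation.
   For k xs: the head of the for loop, xs the vertices of the projection in
   R^(k-1).
   CaseII k x1 x2 c: inside the planar computation of Case II. *)
Inductive conf (R : realType) (n : nat) : Type :=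
| Init of planar_conf R
| For of nat & seq 'rV[R]_n
| CaseII of nat & 'rV[R]_n & 'rV[R]_n & planar_conf R
| Return of {fset 'rV[R]_n}.
Arguments Init {R n}.
Arguments For {R n}.
Arguments CaseII {R n}.
Arguments Return {R n}.

Inductive three_vertex_step (R : realType) (n : nat) (D : 'rV[R]_n -> R) :
    conf R n -> nat -> conf R n -> Prop :=
| StepInit c m c' :
    planar_step (ask_proj2 D) 3 c m c' ->
    three_vertex_step D (Init c) m (Init c')
| StepInitDone (S : {fset 'rV[R]_2}) xs :
    uniq xs -> xs =i [seq pad2 n y | y <- S] ->
    three_vertex_step D (Init (PDone S)) 0 (For 3 xs)
| StepFlat k xs :
    (k <= n)%N -> lower D k = upper D k ->
    three_vertex_step D (For k xs) 2
      (For k.+1 [seq set_coord k (lower D k) x | x <- xs])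
| StepI k x1 :
    (k <= n)%N -> lower D k < upper D k ->
    three_vertex_step D (For k [:: x1]) 2
      (For k.+1 [:: set_coord k (lower D k) x1; set_coord k (upper D k) x1])
| StepII k x1 x2 p :
    (k <= n)%N -> lower D k < upper D k ->
    clockwise p -> [set` p] = vertices (rectangle (lower D k) (upper D k)) ->
    three_vertex_step D (For k [:: x1; x2]) 2
      (CaseII k x1 x2 (PLoop p fset0 0))
| StepIIPlanar k x1 x2 c m c' :
    planar_step (ask_caseII D k x1 x2) 3 c m c' ->
    three_vertex_step D (CaseII k x1 x2 c) m (CaseII k x1 x2 c')
| StepIIDone k x1 x2 (S : {fset 'rV[R]_2}) xs :
    uniq xs -> xs =i [seq caseII_point k x1 x2 y | y <- S] ->
    three_vertex_step D (CaseII k x1 x2 (PDone S)) 0 (For k.+1 xs)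
| StepIII k xs (d : nat -> 'rV[R]_n) (beta : nat -> R) :
    (k <= n)%N -> lower D k < upper D k -> size xs = 3 ->
    (forall j, (j < 3)%N ->
       caseIII_direction k (lower D k) (upper D k) xs j (d j) (beta j)) ->
    three_vertex_step D (For k xs) (2 + 3)
      (For k.+1
         (mkseq (fun j => set_coord k
            (lower D k + (D (d j) - beta j) * (upper D k - lower D k))
            xs`_j) 3))
| StepReturn k xs :
    (n < k)%N ->
    three_vertex_step D (For k xs) 0 (Return [fset x in xs]%fset).

(* Main.v *)
Require Import Defs.
From mathcomp Require Import all_boot all_order all_algebra finmap.
From mathcomp Require Import all_classical all_reals all_analysis.
From mathcomp Require Import ring lra zify.

(** Nothing is assumed about the choices made by the algorithms, so termination,
correctness and the bound on the number of calls are proved together, as the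
existence of a budget of calls that no run overruns: [terminates_within].  A
planar run embeds as a phase of the main program ([terminates_within_embed]).

Polytopes are given by lists in convex position ([reduced]), which are exactly
the lists of vertices of their hulls ([vertices_reduced], [reduced_exists]).

The planar algorithm keeps a polygon [P] around [Y], and every edge of [P]
meets [Y] ([loop_inv]).  Let [a], [b], [c] be consecutive vertices of [P].  The
query direction vanishes along [a c], so that the answer is the largest
barycentric coordinate, with respect to [b] in the triangle [a b c], of a point
of [Y].  If it is attained at [b], then [b] is a point of [Y].  If it is
attained at [a], then [Y] can meet the edges [a b] and [b c] only at [a] and
[c], which are therefore points of [Y].  Otherwise the cut creates an edge that
meets [Y].  The confirmed vertices are consecutive on [P] and end at [a].  Hence
[b] is never confirmed already; and since the loop stops at three confirmed
vertices, a removal that confirms nothing new turns a triangle into a segment.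

The number of calls is controlled by a potential.  A point of [Y] has weight 0
once it is confirmed, 1 if it is a vertex of [P], 2 if it lies on an edge, and 3
in the interior.  Each call lowers the sum of the weights ([keep_step],
[remove_step], [cut_step]), except for a removal of the kind just described,
which is the last call of the loop and requires [Y] to have at most two vertices.  At the
start, a point of weight [w] lies on at most [3 - w] sides of [P], and each side
meets [Y], so the potential is at most [3 m - 3] for a triangle and [3 m - 4]
for a rectangle, where [m] is the number of vertices of [Y].  This gives at most
[2 m] and [2 m - 1] calls in the loop ([planar_triangle], [planar_rectangle]).

The main loop maintains the list of vertices of the projection of [X]
([projected_vertices]).  A projection with two vertices leads to a planar copy of
the next one ([caseII_plane]).  If the projection has three vertices, there is
exactly one vertex of [X] above each of them, and the query for a vertex is the
affine function which is increasing in the height above that vertex and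
nonpositive at the other vertices of [X], so that it reads off the height
([step_three]).  Every round costs at most five calls, except the one in which a
third vertex appears, which costs at most seven ([loop_cost]). *)

Set Implicit Arguments.
Unset Strict Implicit.
Unset Printing Implicit Defensive.

Import Order.TTheory GRing.Theory Num.Theory.
Import numFieldNormedType.Exports.

Local Open Scope classical_set_scope.
Local Open Scope card_scope.
Local Open Scope ring_scope.

(** * Total correctness of nondeterministic programs *)

Section TotalCorrectness.
Variables (C : Type) (step : C -> nat -> C -> Prop).

(** A run that stops does so in a final state satisfying [Q], and never gets stuck
elsewhere: hence the first premise of the second rule.  Infinite runs are
excluded because the predicate is inductive. *)
Inductive terminates_within (Q : C -> Prop) (c : C) (B : nat) : Prop :=
| within_final : halted step c -> Q c -> terminates_within Q c B
| within_step :
    (exists m c', step c m c') ->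
    (forall m c', step c m c' -> (m <= B)%N) ->
    (forall m c', step c m c' -> terminates_within Q c' (B - m)) ->
    terminates_within Q c B.

Lemma terminates_within_leq Q c B B' :
  (B <= B')%N -> terminates_within Q c B -> terminates_within Q c B'.
Proof.
move=> + t; elim: t B' => {c B} [c B hc Qc|c B ex le _ IH] B' BB'.
  exact: within_final.
apply: within_step => // m c' st; first exact: leq_trans (le _ _ st) BB'.
by apply: IH st _ _; rewrite leq_sub2r.
Qed.

(** Same rule as [within_step], with a budget of its own for each successor instead
of a truncated difference. *)
Lemma terminates_within_intro Q c B :
  (exists m c', step c m c') ->
  (forall m c', step c m c' ->
     exists2 B', (m + B' <= B)%N & terminates_within Q c' B') ->
  terminates_within Q c B.
Proof.
move=> ex H; apply: within_step => // m c' /H[B' le t].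
  exact: leq_trans (leq_addr _ _) le.
by apply: terminates_within_leq t; rewrite leq_subRL ?(leq_trans _ le) ?leq_addr.
Qed.

Lemma terminates_within_acc Q c B :
  terminates_within Q c B -> no_infinite_run step c.
Proof.
elim=> {c B} [c B hc _|c B _ _ _ IH]; apply: Acc_intro => c' [m st].
  by case: (hc m c').
exact: IH st.
Qed.

Lemma terminates_within_exec Q c B q c' :
  terminates_within Q c B -> exec step c q c' -> halted step c' ->
  Q c' /\ (q <= B)%N.
Proof.
move=> + e; elim: e B => {c q c'} [c|c1 c2 c3 m q st _ IH] B t hc.
  by case: t => // -[m [c' /hc]].
case: t => [h1|_ le IHt]; first by case: (h1 _ _ st).
have [Q3 le3] := IH _ (IHt _ _ st) hc; split => //.
by rewrite -(subnKC (le _ _ st)) leq_add2l.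
Qed.

End TotalCorrectness.

(** The main program takes exactly the steps of the subprogram until the latter
    halts, and then goes on with a budget [B'] of its own. *)
Lemma terminates_within_embed (C C' : Type) (step : C -> nat -> C -> Prop)
    (step' : C' -> nat -> C' -> Prop) (f : C -> C') (Q : C -> Prop)
    (Q' : C' -> Prop) (B' : nat) :
  (forall c m c', step c m c' -> step' (f c) m (f c')) ->
  (forall c m d, ~ halted step c -> step' (f c) m d ->
     exists2 c', d = f c' & step c m c') ->
  (forall c, halted step c -> Q c -> terminates_within step' Q' (f c) B') ->
  forall c B, terminates_within step Q c B ->
    terminates_within step' Q' (f c) (B + B').
Proof.
move=> up down fin c B; elim=> {c B} [c B hc Qc|c B ex le _ IH].
  by apply: terminates_within_leq (fin _ hc Qc); rewrite leq_addl.
have nh : ~ halted step c by case: ex => m [c' st] /(_ m c').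
apply: within_step.
- by case: ex => m [c' st]; exists m, (f c'); apply: up.
- move=> m d /(down _ _ _ nh)[c' _ /le mB].
  exact: leq_trans mB (leq_addr _ _).
- move=> m d /(down _ _ _ nh)[c' -> st].
  by rewrite -addnBAC ?(le _ _ st)//; apply: IH.
Qed.

(** * Convex hulls and convex position *)

Section Convexity.
Variables (R : realType) (n : nat).
Implicit Types (x y z : 'rV[R]_n) (s : seq 'rV[R]_n) (A : set 'rV[R]_n).

Definition convex A := forall x y (t : R), A x -> A y -> 0 <= t <= 1 ->
  A (t *: x + (1 - t) *: y).

(** Weights indexed by [nat] do not depend on the length of the list, so that
lists can be rewritten under them. *)
Lemma conv_hull_natP s x : conv_hull s x <-> exists w : nat -> R,
  [/\ forall i, (i < size s)%N -> 0 <= w i, \sum_(i < size s) w i = 1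
    & x = \sum_(i < size s) w i *: s`_i].
Proof.
split=> -[w [w0 w1 ->]]; last first.
  by exists (fun i => w i); split => // i; apply: w0.
exists (fun i => if insub i is Some j then w j else 0); split.
- by move=> i _; case: insub.
- by rewrite -w1; apply: eq_bigr => i _; rewrite valK.
- by apply: eq_bigr => i _; rewrite valK.
Qed.

Lemma conv_hull_convex s : convex (conv_hull s).
Proof.
move=> x y t [w [w0 w1 ->]] [v [v0 v1 ->]] /andP[t0 t1].
exists (fun i => t * w i + (1 - t) * v i); split.
- by move=> i; rewrite addr_ge0// mulr_ge0// subr_ge0.
- by rewrite big_split/= -!mulr_sumr w1 v1 !mulr1 subrKC.
- rewrite !scaler_sumr -big_split/=; apply: eq_bigr => i _.
  by rewrite !scalerA -scalerDl.
Qed.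

Lemma mem_conv_hull s x : x \in s -> conv_hull s x.
Proof.
move=> xs; have ix : (index x s < size s)%N by rewrite index_mem.
exists (fun i => (i == Ordinal ix)%:R); split.
- by move=> i; rewrite ler0n.
- by rewrite (bigD1 (Ordinal ix))//= eqxx big1 ?addr0// => i /negPf->.
- rewrite (bigD1 (Ordinal ix))//= eqxx scale1r nth_index// big1 ?addr0//.
  by move=> i /negPf->; rewrite scale0r.
Qed.

(** By induction on the list: the weight of the head is split off and the other
weights are rescaled.  Thanks to this minimality, later proofs manipulate convex
sets instead of weights. *)
Lemma conv_hull_min s A : convex A -> (forall x, x \in s -> A x) ->
  conv_hull s `<=` A.
Proof.
move=> cA; elim: s => [|a s IH] sA x /conv_hull_natP[w [w0 w1 ->]].
  by move: w1; rewrite big_ord0 => /esym/eqP; rewrite oner_eq0.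
have Aa : A a by apply: sA; rewrite mem_head.
rewrite big_ord_recl/= in w1; rewrite big_ord_recl/=.
have w00 : 0 <= w 0%N by exact: w0.
have w'0 i : (i < size s)%N -> 0 <= w i.+1 by move=> lt; apply: w0.
have sw : 0 <= \sum_(i < size s) w i.+1 by apply: sumr_ge0 => i _; apply: w'0.
have w01 : w 0%N = 1 - \sum_(i < size s) w i.+1 by rewrite -w1 addrK.
set S := \sum_(i < size s) w i.+1 in w01 sw w1.
(* The tail cannot be rescaled if all the weight is on the head. *)
have [S0|Sn0] := eqVneq S 0.
  rewrite w01 S0 subr0 scale1r big1 ?addr0// => i _.
  suff -> : w (bump 0 i) = 0 by rewrite scale0r.
  have /psumr_eq0P/(_ S0 i) -> // : forall i : 'I_(size s), true -> 0 <= w i.+1.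
  by move=> j _; apply: w'0.
have Sp : 0 < S by rewrite lt_def Sn0.
have -> : \sum_(i < size s) w (bump 0 i) *: s`_i =
   (1 - w 0%N) *: (\sum_(i < size s) (w i.+1 / S) *: s`_i).
  rewrite w01 opprB addrC subrK scaler_sumr; apply: eq_bigr => i _.
  by rewrite scalerA mulrC divfK// .
apply: cA => //; last by rewrite w00 w01 lerBlDr lerDl.
apply: IH => [x' x's|]; first by apply: sA; rewrite in_cons x's orbT.
apply/conv_hull_natP; exists (fun i => w i.+1 / S); split => //.
- by move=> i /w'0 ?; rewrite divr_ge0.
- by rewrite -mulr_suml divff.
Qed.

Lemma sub_conv_hull s s' : (forall x, x \in s -> conv_hull s' x) ->
  conv_hull s `<=` conv_hull s'.
Proof. by move=> ss; apply: conv_hull_min => //; apply: conv_hull_convex. Qed.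

Lemma eq_conv_hull s s' : s =i s' -> conv_hull s = conv_hull s'.
Proof.
by move=> ss'; apply/seteqP; split; apply: sub_conv_hull => x xs;
  apply: mem_conv_hull; rewrite ?ss' // -ss'.
Qed.

Lemma conv_hull1 x : conv_hull [:: x] = [set x].
Proof.
apply/seteqP; split => [|y ->]; last by apply: mem_conv_hull; rewrite mem_head.
apply: conv_hull_min => [y z t -> -> _|y]; last by rewrite inE => /eqP.
by rewrite -scalerDl subrKC scale1r.
Qed.

Definition all_but x s := [seq y <- s | y != x].

(** The union of the segments from [x] to a convex set is convex. *)
Lemma conv_hull_join s x y : conv_hull s y -> y != x ->
  exists a z, [/\ 0 <= a < 1, conv_hull (all_but x s) z &
    y = a *: x + (1 - a) *: z].
Proof.
move=> /= sy; case: (eqVneq y x) => // + _; apply: contra_neqP.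
move: y sy; suff sub : conv_hull s `<=` [set y | y = x \/ exists a z,
    [/\ 0 <= a < 1, conv_hull (all_but x s) z & y = a *: x + (1 - a) *: z]].
  by move=> y /sub[].
apply: conv_hull_min => [|y ys]; last first.
  have [->|yx] := eqVneq y x; [by left|right].
  exists 0, y; split; [by rewrite lexx ltr01| |by rewrite scale0r add0r subr0 scale1r].
  by apply: mem_conv_hull; rewrite mem_filter yx.
have one y (t : R) : [set y | y = x \/ exists a z,
    [/\ 0 <= a < 1, conv_hull (all_but x s) z & y = a *: x + (1 - a) *: z]] y ->
    exists2 a, 0 <= a <= 1 & (a = 1 /\ y = x) \/ a < 1 /\ exists2 z,
     conv_hull (all_but x s) z & y = a *: x + (1 - a) *: z.
  move=> [->|[a [z [/andP[a0 a1] dz ->]]]].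
    by exists 1; [rewrite ler01 lexx|left].
  by exists a; [rewrite a0 ltW|right; split => //; exists z].
move=> y z t yP zP /andP[t0 t1] /=.
have {yP} [a /andP[a0 a1] Ha] := one _ 0 yP.
have {zP} [b /andP[b0 b1] Hb] := one _ 0 zP.
have comb u v (p q : R) : conv_hull (all_but x s) u -> conv_hull (all_but x s) v ->
  0 <= p -> 0 <= q -> 0 < p + q ->
  exists2 z, conv_hull (all_but x s) z & p *: u + q *: v = (p + q) *: z.
  move=> du dv p0 q0 pq; exists ((p / (p + q)) *: u + (1 - p / (p + q)) *: v).
    apply: conv_hull_convex => //; rewrite divr_ge0 ?addr_ge0//=.
    by rewrite ler_pdivrMr// mul1r lerDl.
  rewrite scalerDr !scalerA mulrBr mulr1 mulrC divfK ?gt_eqF//.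
  by rewrite addrAC subrr add0r.
have [->|tn0] := eqVneq t 0.
  rewrite scale0r add0r subr0 scale1r; case: Hb => [[_ ->]|[lt [u du ->]]]; first by left.
  by right; exists b, u; split; rewrite ?b0.
have [->|tn1] := eqVneq t 1.
  rewrite subrr scale0r addr0 scale1r; case: Ha => [[_ ->]|[lt [u du ->]]]; first by left.
  by right; exists a, u; split; rewrite ?a0.
have tp : 0 < t by rewrite lt_def tn0.
have tq : 0 < 1 - t by rewrite subr_gt0 lt_def eq_sym tn1.
case: Ha => [[a1' ->]|[lta [u du ->]]]; case: Hb => [[b1' ->]|[ltb [v dv ->]]].
- by left; rewrite -scalerDl subrKC scale1r.
- right; exists (t + (1 - t) * b), v; split => //.
  + apply/andP; split; first by rewrite addr_ge0// mulr_ge0// ltW.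
    by nra.
  + rewrite scalerDr !scalerA addrA -scalerDl; congr (_ + _ *: _); ring.
- right; exists (t * a + (1 - t)), u; split => //.
  + apply/andP; split; first by rewrite addr_ge0// ?mulr_ge0// ltW.
    by nra.
  + rewrite scalerDr !scalerA addrAC -scalerDl; congr (_ + _ *: _); ring.
- have [|||w dw e] := comb u v (t * (1 - a)) ((1 - t) * (1 - b)) du dv.
  + by rewrite mulr_ge0 ?subr_ge0 ?ltW // -subr_gt0.
  + by rewrite mulr_ge0 ?subr_ge0 ?ltW // -subr_gt0.
  + by rewrite addr_gt0// mulr_gt0// subr_gt0.
  right; exists (t * a + (1 - t) * b), w; split => //.
  + apply/andP; split; first by rewrite addr_ge0// ?mulr_ge0// ltW.
    by nra.
  + rewrite !scalerDr !scalerA addrACA -scalerDl e; congr (_ + _ *: _); ring.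
Qed.

Definition reduced s := uniq s /\ forall x, x \in s -> ~ conv_hull (all_but x s) x.

(** A vertex different from the head [a] of the list lies on a segment from [a] to
a point of the hull of the tail; being a vertex, it is the other end of that
segment, and induction applies. *)
Lemma vertices_conv_hull_sub s : vertices (conv_hull s) `<=` [set` s].
Proof.
move=> v [sv vP]; apply: contrapT => /negP /= vs.
have dv : all_but v s = s.
  by apply/all_filterP/allP => y ys; apply: contraNneq vs => <-.
elim: s => [|a s IH] in sv vP vs dv *.
  by case: sv => w []; rewrite big_ord0 => _ /esym/eqP; rewrite oner_eq0.
have va : v != a by apply: contraNneq vs => ->; rewrite mem_head.
have [b [z [/andP[b0 b1] dz e]]] := conv_hull_join sv va.
have zs : conv_hull (a :: s) z.
  by apply: sub_conv_hull dz => x; rewrite mem_filter => /andP[_ /mem_conv_hull].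
have as_ : conv_hull (a :: s) a by apply: mem_conv_hull; rewrite mem_head.
have [b00|bn0] := eqVneq b 0; last first.
  have [av _] := vP a z b as_ zs ltac:(by rewrite b1 lt_def bn0 b0) e.
  by rewrite av eqxx in va.
have vz : v = z by rewrite e b00 scale0r subr0 scale1r add0r.
have dS : conv_hull s z.
  apply: sub_conv_hull dz => x; rewrite mem_filter in_cons => /andP[/negPf->].
  exact: mem_conv_hull.
have sub : conv_hull s `<=` conv_hull (a :: s).
  by apply: sub_conv_hull => x xs; apply: mem_conv_hull; rewrite in_cons xs orbT.
apply: IH.
- by rewrite vz.
- by move=> x y t sx sy; apply: vP; apply: sub.
- by apply: contra vs; rewrite in_cons orbC => ->.
- apply/all_filterP/allP => y ys; apply: contraNneq vs => <-.
  by rewrite in_cons ys orbT.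
Qed.

(** If a point [x] of the list were inside a segment of the hull with ends different
from [x], then collecting the contributions of [x] to these ends on the left
would express [x] by the other points of the list. *)
Lemma vertices_reduced s : reduced s -> vertices (conv_hull s) = [set` s].
Proof.
move=> [us rs]; apply/seteqP; split; first exact: vertices_conv_hull_sub.
move=> x /= xs; split; first exact: mem_conv_hull.
move=> y z t sy sz /andP[t0 t1] e.
have red (p q : 'rV[R]_n) (a : R) : a < 1 -> (1 - a) *: x = (1 - a) *: p -> x = p.
  move=> a1 /(congr1 (fun u => (1 - a)^-1 *: u)).
  by rewrite !scalerA mulVf ?scale1r// subr_eq0 gt_eqF.
have [yx|yx] := eqVneq y x.
  split => //; apply/esym/(red z z t) => //.
  by apply: (addrI (t *: x)); rewrite -scalerDl subrKC scale1r {1}e yx.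
exfalso.
have [a [u [/andP[a0 a1] du eu]]] := conv_hull_join sy yx.
have [zx|zx] := eqVneq z x.
  apply: (rs x xs); suff xu : x = u by rewrite {2}xu.
  apply: (red u u (t * a + (1 - t))); first by nra.
  have -> : 1 - (t * a + (1 - t)) = t * (1 - a) by ring.
  apply: (addrI ((t * a + (1 - t)) *: x)); rewrite -scalerDl.
  have -> : t * a + (1 - t) + t * (1 - a) = 1 by ring.
  by rewrite scale1r {1}e {1}eu zx scalerDr !scalerA addrAC -scalerDl.
have [b [v [/andP[b0 b1] dv ev]]] := conv_hull_join sz zx.
set k := t * a + (1 - t) * b.
have k1 : k < 1 by rewrite /k; nra.
set l := t * (1 - a) / (1 - k).
apply: (rs x xs); suff xE : x = l *: u + (1 - l) *: v.
  rewrite {2}xE; apply: conv_hull_convex => //; rewrite /l divr_ge0/=; last 2 first.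
  - by rewrite mulr_ge0 ?subr_ge0// ltW.
  - by rewrite subr_ge0 ltW.
  rewrite ler_pdivrMr ?subr_gt0// mul1r /k; nra.
apply: (red _ u k) => //; rewrite scalerDr !scalerA.
apply: (addrI (k *: x)); rewrite -scalerDl subrKC scale1r.
have -> : (1 - k) * l = t * (1 - a).
  by rewrite /l mulrC divfK// subr_eq0 gt_eqF.
have -> : (1 - k) * (1 - l) = (1 - t) * (1 - b).
  rewrite /l mulrBr mulr1 mulrCA mulfV ?mulr1; last by rewrite subr_eq0 gt_eqF.
  by rewrite /k; ring.
by rewrite {1}e {1}eu {1}ev !scalerDr !scalerA /k scalerDl addrACA addrA.
Qed.

(** Discard redundant points one at a time. *)
Lemma reduced_exists s : exists s', [/\ reduced s', {subset s' <= s}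
  & conv_hull s' = conv_hull s].
Proof.
have [m] := ubnP (size s); elim: m s => // m IH s sm.
have [[x [xs dx]]|H] := pselect (exists x, x \in s /\ conv_hull (all_but x s) x).
  have [|s' [rs' ss' cs']] := IH (all_but x s).
    apply: leq_trans (_ : size s <= m)%N => //.
    by rewrite size_filter -(count_predC (pred1 x) s) -[ltnLHS]add0n ltn_add2r
      -has_count has_pred1.
  exists s'; split => //; first by move=> y /ss'; rewrite mem_filter => /andP[].
  rewrite cs'; apply/seteqP; split; apply: sub_conv_hull => y.
    by rewrite mem_filter => /andP[_ /mem_conv_hull].
  have [->//|yx ys] := eqVneq y x.
  by apply: mem_conv_hull; rewrite mem_filter yx.
exists (undup s); split; last 1 first.
- by apply: eq_conv_hull => y; rewrite mem_undup.
- split; first exact: undup_uniq.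
  move=> x; rewrite mem_undup => xs dx; apply: H; exists x; split => //.
  rewrite (@eq_conv_hull _ (all_but x (undup s)))// => y.
  by rewrite !mem_filter mem_undup.
- by move=> y; rewrite mem_undup.
Qed.

Lemma reduced_unique s s' : reduced s -> reduced s' ->
  conv_hull s = conv_hull s' -> s =i s'.
Proof.
move=> /vertices_reduced vs /vertices_reduced vs' e x.
have : [set` s] x <-> [set` s'] x by rewrite -vs -vs' e.
by move=> /= h; apply/idP/idP => /h.
Qed.

Lemma reduced_sub s s' : reduced s -> conv_hull s = conv_hull s' ->
  {subset s <= s'}.
Proof.
move=> rs e x xs; have : vertices (conv_hull s) x by rewrite vertices_reduced.
by rewrite e => /vertices_conv_hull_sub.
Qed.

Lemma eq_reduced s s' : s =i s' -> uniq s' -> reduced s -> reduced s'.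
Proof.
move=> ss' us' [_ rs]; split => // x xs' dx; apply: (rs x); first by rewrite ss'.
by rewrite (@eq_conv_hull _ (all_but x s'))// => y; rewrite !mem_filter ss'.
Qed.

Lemma reduced_notin_segment s x y z (t : R) : reduced s -> x \in s -> y \in s ->
  z \in s -> x != z -> y != z -> 0 <= t <= 1 -> z <> t *: x + (1 - t) *: y.
Proof.
move=> [_ rs] xs ys zs xz yz t01 e; apply: (rs z zs); rewrite {2}e.
by apply: conv_hull_convex => //; apply: mem_conv_hull; rewrite mem_filter ?xz ?yz.
Qed.

Lemma reduced2 x y : x != y -> reduced [:: x; y].
Proof.
move=> xy; split; first by rewrite /= inE xy.
have h (u v : 'rV[R]_n) : u != v -> ~ conv_hull [:: u] v.
  by move=> uv; rewrite conv_hull1 => e; rewrite e eqxx in uv.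
move=> z; rewrite !inE => /orP[]/eqP->; rewrite /all_but /= eqxx /=.
  by rewrite eq_sym xy; apply: h; rewrite eq_sym.
by rewrite xy; apply: h.
Qed.

End Convexity.

Lemma conv_hull_le (R : realType) (n : nat) (s : seq 'rV[R]_n) f (r : R) :
  (forall x y t, f (t *: x + (1 - t) *: y) = t * f x + (1 - t) * f y) ->
  (forall x, x \in s -> f x <= r) -> forall x, conv_hull s x -> f x <= r.
Proof.
move=> fa sr x; apply: (@conv_hull_min _ _ s [set x | f x <= r]) => // y z t fy fz.
move=> /andP[t0 t1] /=; rewrite fa; move: fy fz => /= fy fz; nra.
Qed.

Lemma conv_hull2 (R : realType) (n : nat) (x y z : 'rV[R]_n) : conv_hull [:: x; y] z ->
  exists2 s : R, 0 <= s <= 1 & z = x + s *: (y - x).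
Proof.
move: z; apply: conv_hull_min => [_ _ t [s s01 ->] [r r01 ->] t01|z].
  exists (t * s + (1 - t) * r).
    case/andP: s01 => *; case/andP: r01 => *; case/andP: t01 => *.
    by apply/andP; split; nra.
  by apply/rowP => i; rewrite !mxE; ring.
rewrite !inE => /orP[]/eqP->; first by exists 0; rewrite ?lexx ?ler01// scale0r addr0.
by exists 1; rewrite ?lexx ?ler01// scale1r addrC subrK.
Qed.

Definition affine (R : realType) (n m : nat) (f : 'rV[R]_n -> 'rV[R]_m) :=
  forall (x y : 'rV[R]_n) (t : R),
    f (t *: x + (1 - t) *: y) = t *: f x + (1 - t) *: f y.

Section AffineMaps.
Variables (R : realType) (n m : nat) (f : 'rV[R]_n -> 'rV[R]_m).
Hypothesis f_affine : affine f.
Implicit Type s : seq 'rV[R]_n.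

Lemma conv_hull_map s : conv_hull (map f s) = f @` conv_hull s.
Proof.
apply/seteqP; split.
  apply: conv_hull_min => [|y /mapP[x xs ->]]; last first.
    by exists x => //; apply: mem_conv_hull.
  move=> _ _ t [x sx <-] [y sy <-] t01.
  exists (t *: x + (1 - t) *: y); first exact: conv_hull_convex.
  exact: f_affine.
move=> _ [x sx <-]; apply: (@conv_hull_min _ _ s [set x | conv_hull (map f s) (f x)]) sx.
  by move=> y z t fy fz t01 /=; rewrite f_affine; apply: conv_hull_convex.
by move=> y ys /=; apply/mem_conv_hull/map_f.
Qed.

(** An affine map sends a redundant point to a redundant point. *)
Lemma reduced_of_map s : reduced (map f s) -> reduced s.
Proof.
move=> [/[dup] /map_uniq us ufs rs]; split => // x xs dx.
apply: (rs (f x)); first exact: map_f.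
have : conv_hull (map f (all_but x s)) (f x) by rewrite conv_hull_map; exists x.
apply: sub_conv_hull => y /mapP[z]; rewrite mem_filter => /andP[zx zs] ->.
apply: mem_conv_hull; rewrite mem_filter map_f// andbT.
apply: contraNneq zx => e; apply/eqP.
have := e; rewrite -[in f z](nth_index 0 zs) -[in f x](nth_index 0 xs).
move=> /eqP; rewrite -!(nth_map 0 0 f) ?index_mem// nth_uniq ?size_map ?index_mem//.
by move=> /eqP ei; rewrite -(nth_index 0 zs) ei nth_index.
Qed.

Lemma reduced_map s :
  (forall x y, conv_hull s x -> conv_hull s y -> f x = f y -> x = y) ->
  reduced s -> reduced (map f s).
Proof.
move=> inj [us rs]; split.
  rewrite map_inj_in_uniq// => x y xs ys; apply: inj; exact: mem_conv_hull.
move=> _ /mapP[x xs ->] dx; apply: (rs x xs).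
have : conv_hull (map f (all_but x s)) (f x).
  apply: sub_conv_hull dx => y; rewrite mem_filter => /andP[yx /mapP[z zs e]].
  apply: mem_conv_hull; rewrite e map_f// mem_filter zs andbT.
  by apply: contraNneq yx => <-; rewrite e.
rewrite conv_hull_map => -[z dz e].
have zs : conv_hull s z.
  by apply: sub_conv_hull dz => y; rewrite mem_filter => /andP[_ /mem_conv_hull].
by have xz := inj _ _ (mem_conv_hull xs) zs (esym e); rewrite {2}xz.
Qed.

End AffineMaps.

(** * Dot products and support functions *)

Section DotProduct.
Variables (R : realType) (n : nat).
Implicit Types (u v w x d : 'rV[R]_n) (s : seq 'rV[R]_n) (r : R).

Lemma dotpE u v : dotp u v = \sum_i u 0 i * v 0 i.
Proof. by rewrite /dotp mxE; apply: eq_bigr => i _; rewrite mxE. Qed.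

Lemma dotpC u v : dotp u v = dotp v u.
Proof. by rewrite !dotpE; apply: eq_bigr => i _; rewrite mulrC. Qed.

Lemma dotpDl u v w : dotp (u + v) w = dotp u w + dotp v w.
Proof. by rewrite /dotp mulmxDl mxE. Qed.

Lemma dotpZl a u v : dotp (a *: u) v = a * dotp u v.
Proof. by rewrite /dotp -scalemxAl mxE. Qed.

Lemma dotpNl u v : dotp (- u) v = - dotp u v.
Proof. by rewrite -scaleN1r dotpZl mulN1r. Qed.

Lemma dotpBl u v w : dotp (u - v) w = dotp u w - dotp v w.
Proof. by rewrite dotpDl dotpNl. Qed.

Lemma dotpDr u v w : dotp u (v + w) = dotp u v + dotp u w.
Proof. by rewrite dotpC dotpDl !(dotpC u). Qed.

Lemma dotpZr a u v : dotp u (a *: v) = a * dotp u v.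
Proof. by rewrite dotpC dotpZl dotpC. Qed.

Lemma dotpNr u v : dotp u (- v) = - dotp u v.
Proof. by rewrite dotpC dotpNl dotpC. Qed.

Lemma dotpBr u v w : dotp u (v - w) = dotp u v - dotp u w.
Proof. by rewrite dotpDr dotpNr. Qed.

Lemma dotp_ge0 x : 0 <= dotp x x.
Proof. by rewrite dotpE; apply: sumr_ge0 => i _; rewrite -expr2 sqr_ge0. Qed.

Lemma dotp_eq0 x : dotp x x = 0 -> x = 0.
Proof.
rewrite dotpE => /psumr_eq0P h; apply/rowP => i; rewrite mxE.
have /eqP : x 0 i * x 0 i = 0 by apply: h => // j _; rewrite -expr2 sqr_ge0.
by rewrite mulf_eq0 orbb => /eqP.
Qed.

Lemma dotp_gt0 x : x != 0 -> 0 < dotp x x.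
Proof. by move=> x0; rewrite lt_def dotp_ge0 andbT; apply: contra_neq x0 => /dotp_eq0. Qed.

(** [r] is the value at [d] of the support function of the hull of [ys]. *)
Definition support_value (ys : seq 'rV[R]_n) d r :=
  (exists2 y, y \in ys & dotp d y = r) /\ forall y, y \in ys -> dotp d y <= r.

(** The open half-space where the linear form is below [r] is convex: if it contained
the whole list, it would contain the hull. *)
Lemma support_hull s d r : (exists2 y, conv_hull s y & dotp d y = r) ->
  (forall y, conv_hull s y -> dotp d y <= r) -> support_value s d r.
Proof.
move=> [y sy yr] le; split; last by move=> z /mem_conv_hull; apply: le.
apply: contrapT => H; suff : dotp d y < r by rewrite yr ltxx.
apply: (@conv_hull_min _ _ s [set y | dotp d y < r]) sy => [u v t|z zs] /=.
  move=> hu hv /andP[t0 t1]; rewrite dotpDr !dotpZr.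
  have [->|tn0] := eqVneq t 0; first by rewrite mul0r subr0 mul1r add0r.
  have tp : 0 < t by rewrite lt_def tn0.
  have h1 : 0 < t * (r - dotp d u) by rewrite mulr_gt0 ?subr_gt0.
  have h2 : 0 <= (1 - t) * (r - dotp d v) by rewrite mulr_ge0 ?subr_ge0// ltW.
  lra.
rewrite lt_neqAle le ?andbT; last exact: mem_conv_hull.
by apply/eqP => e; apply: H; exists z.
Qed.

Lemma support_hull_eq s s' d r : conv_hull s = conv_hull s' ->
  support_value s d r -> support_value s' d r.
Proof.
move=> ss' [[y ys yr] le]; apply: support_hull; rewrite -ss'.
  by exists y => //; apply: mem_conv_hull.
by apply: conv_hull_le => // u v t; rewrite dotpDr !dotpZr.
Qed.

End DotProduct.

Section ThreePoints.
Variables (R : realType) (n : nat).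
Implicit Types (x y z : 'rV[R]_n) (s : seq 'rV[R]_n).

(** Three points in convex position are affinely independent, so a linear form
    can be prescribed on the two differences. *)
Lemma reduced3_direction s x y z : reduced s -> x \in s -> y \in s -> z \in s ->
  x != y -> x != z -> y != z -> exists a b : R,
  let d := a *: (y - x) + b *: (z - x) in
  dotp d (y - x) = -1 /\ dotp d (z - x) = -1.
Proof.
move=> rs xs ys zs xy xz yz; set v := y - x; set w := z - x.
pose p := dotp v v; pose q := dotp w w; pose m := dotp v w.
have p0 : 0 < p by rewrite /p dotp_gt0// subr_eq0 eq_sym.
(* The Gram determinant of [v] and [w]; if it vanishes, then the three points are
   on a line, and one of them is between the two others. *)
have G0 : p * q - m ^+ 2 != 0.
  apply/eqP => G0; have : m *: v - p *: w = 0.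
    apply: dotp_eq0; rewrite dotpBl !dotpBr !dotpZl !dotpZr (dotpC w v).
    rewrite -/p -/q -/m; transitivity (p * (p * q - m ^+ 2)); first by ring.
    by rewrite G0 mulr0.
  move/eqP; rewrite subr_eq0 => /eqP wE.
  have zE : z = x + (m / p) *: (y - x).
    apply: (addIr (- x)); rewrite -/w addrAC subrr add0r -/v.
    by rewrite mulrC -scalerA wE scalerA mulVf ?scale1r// gt_eqF.
  move: zE; set t := m / p => zE.
  have [t0|t0] := ltP t 0.
    apply: (@reduced_notin_segment _ _ s y z x (- t / (1 - t))) => //; rewrite 1?eq_sym//.
      apply/andP; split; first by rewrite divr_ge0; lra.
      by rewrite ler_pdivrMr ?mul1r; lra.
    have n0 : 1 - t != 0 by rewrite gt_eqF//; lra.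
    by rewrite zE; apply/rowP => i; rewrite !mxE; field.
  have [t1|t1] := lerP t 1.
    apply: (@reduced_notin_segment _ _ s y x z t) => //; rewrite 1?eq_sym// ?t0//.
    by rewrite zE; apply/rowP => i; rewrite !mxE; ring.
  apply: (@reduced_notin_segment _ _ s z x y t^-1) => //; rewrite 1?eq_sym//.
    by rewrite invr_ge0 t0 invf_le1 ?(ltW t1)// (lt_trans ltr01).
  have n0 : t != 0 by rewrite gt_eqF// (lt_trans ltr01).
  by rewrite zE; apply/rowP => i; rewrite !mxE; field.
(* Cramer's rule for the Gram matrix. *)
exists ((m - q) / (p * q - m ^+ 2)), ((m - p) / (p * q - m ^+ 2)) => /=.
rewrite -/v -/w !dotpDl !dotpZl (dotpC w v) -/p -/q -/m.
by split; field; rewrite ?mulrN -?expr2.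
Qed.

End ThreePoints.

(** * Clockwise enumerations *)

Lemma nth_rot (T : Type) (x0 : T) (k : nat) (s : seq T) (j : nat) :
  (k <= size s)%N -> (j < size s)%N ->
  nth x0 (rot k s) j = nth x0 s ((k + j) %% size s).
Proof.
move=> ks js; rewrite /rot nth_cat size_drop nth_drop.
case: ltnP => h; first by rewrite modn_small//; lia.
rewrite nth_take; last lia.
congr nth; have -> : (k + j = size s + (j - (size s - k)))%N by lia.
by rewrite modnDl modn_small//; lia.
Qed.

Section PlaneGeometry.
Variable R : realType.
Notation pt := 'rV[R]_2.
Implicit Types (a b c u v x y z : pt) (p q s : seq pt) (t r : R).

Lemma pt_eqP u v : u = v <-> u 0 0 = v 0 0 /\ u 0 1 = v 0 1.
Proof.
split=> [->//|[e0 e1]]; apply/rowP => i.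
by case: (unliftP 0 i) => [j ->|->//]; rewrite (ord1 j);
  rewrite (_ : lift 0 0 = 1)//; apply: val_inj.
Qed.

Lemma dotp2E u v : dotp u v = u 0 0 * v 0 0 + u 0 1 * v 0 1.
Proof.
by rewrite dotpE big_ord_recl big_ord1 (_ : lift 0 0 = 1)//; apply: val_inj.
Qed.

(** Twice the signed area of the triangle; negative for a clockwise turn. *)
Definition area u v w := cross (v - u) (w - u).

Lemma areaE u v w : area u v w =
  (v 0 0 - u 0 0) * (w 0 1 - u 0 1) - (v 0 1 - u 0 1) * (w 0 0 - u 0 0).
Proof. by rewrite /area /cross !mxE. Qed.

Lemma area_rot u v w : area v w u = area u v w.
Proof. by rewrite !areaE; ring. Qed.

Lemma area_swap u v w : area u w v = - area u v w.
Proof. by rewrite !areaE; ring. Qed.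

Lemma area_uu u v : area u u v = 0.
Proof. by rewrite !areaE; ring. Qed.

Lemma area_uvu u v : area u v u = 0.
Proof. by rewrite !areaE; ring. Qed.

Lemma area_uvv u v : area u v v = 0.
Proof. by rewrite !areaE; ring. Qed.

Definition mix t u v : pt := (1 - t) *: u + t *: v.

Definition segment u v : set pt := [set y | exists2 t, 0 <= t <= 1 & y = mix t u v].

Lemma area_mix t u v x y : area x y (mix t u v) =
  (1 - t) * area x y u + t * area x y v.
Proof. by rewrite !areaE !mxE; ring. Qed.

Lemma dotp_mix t u v d : dotp d (mix t u v) = (1 - t) * dotp d u + t * dotp d v.
Proof. by rewrite dotpDr !dotpZr. Qed.

(** The orientation part of [clockwise], in a form that computes on lists. *)
Fixpoint cw s := if s is x :: s' then
  pairwise (fun y z => area x y z < 0) s' && cw s' else true.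

Lemma cwP s : reflect (forall i j k, (i < j)%N -> (j < k)%N -> (k < size s)%N ->
  area s`_i s`_j s`_k < 0) (cw s).
Proof.
elim: s => [|x s IH] /=; first by apply: ReflectT.
apply: (iffP andP) => [[/(pairwiseP 0) xs /IH cs] [|i] [|j] [|k]//= ij jk|H].
- by rewrite ltnS => ks; apply: xs => //; rewrite inE; apply: ltn_trans ks.
- by rewrite ltnS; apply: cs.
- split; last by apply/IH => i j k ij jk ks; apply: (H i.+1 j.+1 k.+1).
  by apply/(pairwiseP 0) => j k _ ks jk; apply: (H 0%N j.+1 k.+1).
Qed.

Lemma clockwiseP p : clockwise p <-> uniq p /\ cw p.
Proof.
by split=> -[up H]; split => //; [apply/cwP|move/cwP : H] => H' i j k;
  [apply: H|apply: H'].
Qed.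

Lemma cw_rcons s x : cw (rcons s x) = cw s && pairwise (fun y z => area y z x < 0) s.
Proof.
elim: s => //= y s ->; rewrite pairwise_rcons -!andbA; do !bool_congr.
Qed.

(** The orientation of a triple is invariant under cyclic shifts. *)
Lemma cw_rot1 s : cw (rot 1 s) = cw s.
Proof.
case: s => //= x s; rewrite rot1_cons cw_rcons andbC; congr (_ && _).
by apply: eq_pairwise => y z; rewrite area_rot.
Qed.

Lemma rot_ind (P : seq pt -> seq pt -> Prop) :
  (forall s, P s s) -> (forall s1 s2, P s1 s2 -> P s1 (rot 1 s2)) ->
  forall k s, (k <= size s)%N -> P s (rot k s).
Proof.
move=> P0 PS; elim=> [|k IH] s ks; first by rewrite rot0.
by rewrite rotS//; apply/PS/IH/ltnW.
Qed.

Lemma cw_rot k s : cw (rot k s) = cw s.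
Proof.
have [ks|/ltnW/rot_oversize->//] := leqP k (size s).
by apply: (rot_ind (P := fun s1 s2 => cw s2 = cw s1)) ks => // s1 s2 <-; exact: cw_rot1.
Qed.

Lemma cw_uniq s : (2 < size s)%N -> cw s -> uniq s.
Proof.
case: s => [|x [|y [|z s]]]// _ /andP[xs cs]; rewrite cons_uniq; apply/andP; split.
  move: xs; rewrite pairwise_cons => /andP[/allP xy _].
  have xz := xy z (mem_head _ _).
  rewrite in_cons; apply/norP; split.
    by apply/eqP => e; rewrite e area_uu ltxx in xz.
  by apply/negP => /xy; rewrite area_uvu ltxx.
by apply: pairwise_uniq xs => y'; rewrite area_uvv ltxx.
Qed.

(** A clockwise enumeration is determined by its first point and its set of
    points: seen from the first point, the others are sorted by angle. *)
Lemma cw_inj x s s' : cw (x :: s) -> cw (x :: s') -> uniq (x :: s) ->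
  uniq (x :: s') -> x :: s =i x :: s' -> s = s'.
Proof.
move=> /andP[xs _] /andP[xs' _] /andP[xNs us] /andP[xNs' us'] e.
apply: pairwise_eq xs xs' _ => [y z|].
  by rewrite (area_swap x y z) oppr_lt0 => /andP[h1 h2]; have := lt_trans h1 h2;
    rewrite ltxx.
apply: uniq_perm => // y; have := e y; rewrite !in_cons.
by have [->|//] := eqVneq y x; rewrite (negPf xNs) (negPf xNs').
Qed.

Lemma cw_inj_last x s s' : cw (rcons s x) -> cw (rcons s' x) -> uniq (rcons s x) ->
  uniq (rcons s' x) -> rcons s x =i rcons s' x -> s = s'.
Proof.
rewrite -!rot1_cons !cw_rot !rot_uniq => cs cs' us us' e.
by apply: cw_inj cs cs' us us' _ => y; have := e y; rewrite !mem_rot.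
Qed.

Fixpoint pairs x s := if s is y :: s' then (x, y) :: pairs y s' else [::].
Definition edges q := if q is x :: s then pairs x (rcons s x) else [::].

Lemma pairs_rcons x s y : pairs x (rcons s y) = rcons (pairs x s) (last x s, y).
Proof. by elim: s x => //= z s IH x; rewrite IH. Qed.

Lemma edges_cons x y s : edges (x :: y :: s) =
  (x, y) :: rcons (pairs y s) (last y s, x).
Proof. by rewrite /= pairs_rcons. Qed.

Lemma edges_rot1 q : edges (rot 1 q) =i edges q.
Proof.
case: q => [|x [|y s]]// e; rewrite rot1_cons rcons_cons.
by rewrite /= pairs_rcons last_rcons mem_rcons.
Qed.

Lemma edges_rot k q : edges (rot k q) =i edges q.
Proof.
have [ks|/ltnW/rot_oversize->//] := leqP k (size q).
apply: (rot_ind (P := fun s1 s2 => edges s2 =i edges s1)) ks => // s1 s2 h e.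
by rewrite edges_rot1 h.
Qed.

Lemma mem_pairs x s e : e \in pairs x s -> e.1 \in x :: s /\ e.2 \in s.
Proof.
elim: s x => //= y s IH x; rewrite in_cons => /predU1P[->|/IH[h1 h2]].
  by rewrite !in_cons !eqxx.
by rewrite in_cons h1 orbT in_cons h2 orbT.
Qed.

Lemma eq_edges_cw p q : cw p -> cw q -> uniq p -> uniq q -> p =i q ->
  edges p =i edges q.
Proof.
case: p => [|x s] cp cq up uq e.
  by case: q e {cq uq} => // y q /(_ y); rewrite mem_head.
have xq : x \in q by rewrite -e mem_head.
have [k s' er] := rot_to xq.
suff -> : s = s' by rewrite -er => z; rewrite edges_rot.
apply: (@cw_inj x); rewrite // -er ?cw_rot ?rot_uniq// => y.
by rewrite mem_rot e.
Qed.

(** The polygon as seen by the loop at index [i]: [b, c, ..., a]. *)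
Definition view p i := rot (i.+1 %% size p) p.

Lemma size_view p i : size (view p i) = size p.
Proof. exact: size_rot. Qed.

Lemma mem_view p i : view p i =i p.
Proof. exact: mem_rot. Qed.

Lemma cyc_view p i j : (j < size p)%N -> cyc p (i.+1 + j) = (view p i)`_j.
Proof.
move=> js; rewrite /cyc /view nth_rot//; first by rewrite modnDml.
by rewrite ltnW// ltn_mod; case: (size p) js.
Qed.

Lemma viewS p i : view p i.+1 = rot 1 (view p i).
Proof.
have [->//|p0] := eqVneq p [::].
have sp : (0 < size p)%N by case: p p0.
apply: (@eq_from_nth _ 0) => [|j]; first by rewrite [RHS]size_rot !size_view.
rewrite size_view => js; rewrite -cyc_view// [RHS]nth_rot ?size_view// -cyc_view.
  by rewrite /cyc -[in RHS]modnDmr modn_mod modnDmr addnA addn1 addSn.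
by rewrite ltn_mod.
Qed.

Lemma view_surj q i : exists2 p, size p = size q & view p i = q.
Proof.
exists (rotr (i.+1 %% size q) q); first by rewrite size_rotr.
by rewrite /view size_rotr rotrK.
Qed.

Lemma cyc_last p i : p != [::] -> cyc p i = last 0 (view p i).
Proof.
move=> p0; have sp : (0 < size p)%N by case: p p0.
rewrite -nth_last size_view -cyc_view ?prednK//.
by rewrite /cyc addSnnS prednK// modnDr.
Qed.

(** Barycentric coordinates with respect to the triangle [a b c]. *)
Lemma baryE a b c y : area a b c != 0 -> y = (area b c y / area a b c) *: a +
  (area c a y / area a b c) *: b + (area a b y / area a b c) *: c.
Proof.
rewrite !areaE => A0; apply/pt_eqP; rewrite !mxE; split; field; apply: contra_neq A0 =>
    <-; ring.
Qed.

Lemma bary1 a b c y : area b c y + area c a y + area a b y = area a b c.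
Proof. by rewrite !areaE; ring. Qed.

End PlaneGeometry.

(** * Cutting off a corner of a convex polygon *)

Section Interior.
Variable R : realType.
Notation pt := 'rV[R]_2.

(** Used to recognize boundary points, as points from which some ray leaves the
set at once. *)
Lemma interior_ray (A : set pt) (x w : pt) : interior A x ->
  exists2 t : R, 0 < t & A (x + t *: w).
Proof.
move=> /= Ax.
have cont : (fun t : R => x + t *: w) @ (0 : R) --> x.
  have -> : nbhs x = nbhs (x + (0 : R) *: w) by rewrite scale0r addr0.
  by apply: cvgD; [exact: cvg_cst|apply: cvgZr_tmp; exact: cvg_id].
have /nbhs_ballP[e /= e0 He] := cont _ Ax.
exists (e / 2); first exact: divr_gt0.
apply: (He (e / 2)); rewrite /ball/= sub0r normrN gtr0_norm ?divr_gt0//.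
by rewrite ltr_pdivrMr// ltr_pMr// ltr1n.
Qed.

Lemma area_continuous (u v : pt) : continuous (area u v).
Proof.
move=> y; rewrite (_ : area u v = fun z => (v 0 0 - u 0 0) * (z 0 1 - u 0 1) -
  (v 0 1 - u 0 1) * (z 0 0 - u 0 0)); last by apply/funext => z; rewrite areaE.
apply: (@cvgB _ _ _ (nbhs y)); apply: cvgMl_tmp; apply: (@cvgB _ _ _ (nbhs y));
  by [exact: cvg_cst|exact: coord_continuous].
Qed.

Lemma interior_area3 (A : set pt) (a b c x : pt) :
  (forall y, area a b y < 0 -> area b c y < 0 -> area c a y < 0 -> A y) ->
  area a b x < 0 -> area b c x < 0 -> area c a x < 0 -> interior A x.
Proof.
move=> HA h1 h2 h3.
have op u v : area u v x < 0 -> \forall y \near x, area u v y < 0.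
  by move=> h; apply: (cvgr_lt _ (@area_continuous u v x)).
rewrite /interior /=; near=> y; apply: HA; near: y; exact: op.
Unshelve. all: by end_near. Qed.

End Interior.

(** The corner of a clockwise polygon at [b], between its neighbours [a] and [c].
The barycentric coordinate [tau] is 1 at [b], vanishes on the line [a c], and is
nonpositive at the other vertices. *)
Section Corner.
Variable R : realType.
Notation pt := 'rV[R]_2.
Variables (b c : pt) (rest : seq pt).
Hypothesis rest0 : rest != [::].
Let q := [:: b, c & rest].
Hypothesis cwq : cw q.
Let a := last c rest.
Let tau y := area c a y / area a b c.
Implicit Types y z d : pt.

Lemma a_rest : a \in rest.
Proof. by rewrite /a; case: rest rest0 => //= x s _; apply: mem_last. Qed.

Lemma cw_bc z : z \in rest -> area b c z < 0.
Proof. by case/andP: cwq => /andP[/allP h _] _; apply: h. Qed.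

Lemma corner_lt0 : area a b c < 0.
Proof. by rewrite -area_rot; apply/cw_bc/a_rest. Qed.

Lemma cw_cons_last (x : pt) (s : seq pt) z : cw (x :: s) -> z \in s -> z != last x s ->
  area x z (last x s) < 0.
Proof.
case/lastP: s => // s y; rewrite last_rcons /= pairwise_rcons => /andP[/andP[/allP xs _] _].
by rewrite mem_rcons in_cons => /predU1P[->|/xs//]; rewrite eqxx.
Qed.

Lemma ca_ge0 z : z \in c :: rest -> 0 <= area c a z.
Proof.
rewrite in_cons => /predU1P[->|zr]; first by rewrite area_uvu.
have [->|za] := eqVneq z a; first by rewrite area_uvv.
rewrite area_swap oppr_ge0 ltW// cw_cons_last//.
by case/andP: cwq.
Qed.

Lemma ab_le0 z : z \in q -> area a b z <= 0.
Proof.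
rewrite in_cons => /predU1P[->|]; first by rewrite area_uvv.
have [->|za] := eqVneq z a; first by rewrite area_uvu.
move=> zr; rewrite -area_rot ltW//.
have -> : a = last b (c :: rest) by [].
exact: cw_cons_last.
Qed.

Lemma bc_le0 z : z \in q -> area b c z <= 0.
Proof.
rewrite !in_cons => /predU1P[->|/predU1P[->|/cw_bc/ltW//]].
  by rewrite area_uvu.
by rewrite area_uvv.
Qed.

Lemma tau_b : tau b = 1.
Proof. by rewrite /tau (area_rot b c a) (area_rot a b c) divff// lt_eqF// corner_lt0. Qed.

Lemma tau_le0 z : z \in c :: rest -> tau z <= 0.
Proof. by move=> /ca_ge0 h; rewrite /tau mulr_ge0_le0// invr_le0 ltW// corner_lt0. Qed.

Lemma tau_mix t y z : tau (mix t y z) = (1 - t) * tau y + t * tau z.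
Proof. by rewrite /tau area_mix mulrDl !mulrA. Qed.

Lemma corner_bary y : y = (area b c y / area a b c) *: a + tau y *: b +
  (area a b y / area a b c) *: c.
Proof. by apply: baryE; rewrite lt_eqF// corner_lt0. Qed.

Lemma corner_bary1 y : area b c y / area a b c + tau y + area a b y / area a b c = 1.
Proof. by rewrite /tau -!mulrDl bary1 divff// lt_eqF// corner_lt0. Qed.

Lemma divA_ge0 r : (0 <= r / area a b c) = (r <= 0).
Proof. by rewrite ler_ndivlMr ?corner_lt0// mul0r. Qed.

(** A query direction of the loop is an increasing affine function of [tau]. *)
Lemma cut_dotp d y : dotp d a = dotp d c ->
  dotp d y = dotp d a + tau y * (dotp d b - dotp d a).
Proof.
move=> e; rewrite {1}(corner_bary y) !dotpDr !dotpZr -e.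
have := corner_bary1 y; set l := _ / _; set m := _ / _ => h.
have -> : l = 1 - tau y - m by rewrite -h; ring.
ring.
Qed.

Lemma cut_direction_exists : exists2 d, dotp d a = dotp d c & dotp d a < dotp d b.
Proof.
(* The vector from [c] to [a], turned by a right angle away from the polygon. *)
exists (\row_i (if i == 0 then a 0 1 - c 0 1 else c 0 0 - a 0 0)).
  by rewrite !dotp2E !mxE/=; ring.
rewrite -subr_gt0; have := corner_lt0; rewrite -oppr_gt0 areaE => h.
by rewrite !dotp2E !mxE/=; move: h; congr (_ < _); ring.
Qed.

Section Cut.
Variable t : R.
Hypothesis t01 : 0 < t < 1.
Let beta := mix t a b.
Let gamma := mix t c b.
Let t_gt0 : 0 < t. Proof. by case/andP: t01. Qed.
Let t_lt1 : 0 < 1 - t. Proof. by rewrite subr_gt0; case/andP: t01. Qed.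

Lemma tau_beta : tau beta = t.
Proof. by rewrite tau_mix tau_b /tau area_uvv mul0r mulr0 add0r mulr1. Qed.

Lemma tau_gamma : tau gamma = t.
Proof. by rewrite tau_mix tau_b /tau area_uvu mul0r mulr0 add0r mulr1. Qed.

Lemma beta_notin : beta \notin q.
Proof.
apply/negP; rewrite in_cons => /predU1P[e|/tau_le0]; last by rewrite tau_beta leNgt t_gt0.
by have := tau_beta; rewrite e tau_b => e'; move: t_lt1; rewrite -e' subrr ltxx.
Qed.

Lemma gamma_notin : gamma \notin q.
Proof.
apply/negP; rewrite in_cons => /predU1P[e|/tau_le0]; last by rewrite tau_gamma leNgt t_gt0.
by have := tau_gamma; rewrite e tau_b => e'; move: t_lt1; rewrite -e' subrr ltxx.
Qed.

(** Areas are affine in each argument, so the areas of the new triangles are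
combinations with positive coefficients of areas of old ones. *)
Lemma cw_cut : cw [:: beta, gamma, c & rest].
Proof.
have cwt : cw (c :: rest) by case/andP: cwq.
have bt : pairwise (fun y z => area b y z < 0) (c :: rest) by case/andP: cwq.
have A0 := corner_lt0.
have beta_gamma z : z \in c :: rest -> area beta gamma z < 0.
  move=> zr; have -> : area beta gamma z = (1 - t) * (- ((1 - t) * area c a z) +
      t * (area a b z + area b c z)) by rewrite !areaE !mxE; ring.
  rewrite pmulr_rlt0// ; have := ca_ge0 zr.
  have zq : z \in q by rewrite in_cons zr orbT.
  have := ab_le0 zq; have := bc_le0 zq.
  have : area b c z < 0 \/ area a b z < 0.
    by move: zr; rewrite in_cons => /predU1P[->|/cw_bc]; [right|left].
  move=> h h1 h2 h3; have h4 : area a b z + area b c z < 0 by case: h => h; lra.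
  have h5 : 0 <= (1 - t) * area c a z by rewrite mulr_ge0// ltW.
  have h6 : t * (area a b z + area b c z) < 0 by rewrite pmulr_rlt0.
  lra.
have [u [ru usub]] : exists u, c :: rest = rcons u a /\ {subset u <= c :: rest}.
  exists (belast c rest); split; first exact: lastI.
  by move=> z; apply: mem_belast.
have betaE y z : area beta y z = (1 - t) * area a y z + t * area b y z.
  by rewrite !areaE !mxE; ring.
have gammaE y z : area gamma y z = (1 - t) * area c y z + t * area b y z.
  by rewrite !areaE !mxE; ring.
have comb (r1 r2 r : R) : r = (1 - t) * r1 + t * r2 -> r1 < 0 -> r2 < 0 -> r < 0.
  move=> -> r10 r20; have h1 : (1 - t) * r1 < 0 by rewrite pmulr_rlt0.
  have h2 : t * r2 < 0 by rewrite pmulr_rlt0.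
  lra.
have gammaP : pairwise (fun y z => area gamma y z < 0) (c :: rest).
  move: bt cwt => /= /andP[/allP b1 b2] /andP[c1 _]; apply/andP; split.
    by apply/allP => z /b1 h; rewrite gammaE area_uu mulr0 add0r pmulr_rlt0.
  have : pairwise (fun y z => (area b y z < 0) && (area c y z < 0)) rest.
    by rewrite pairwise_relI b2 c1.
  apply: sub_pairwise => y z /andP[h1 h2].
  exact: comb (gammaE y z) h2 h1.
have betaP : pairwise (fun y z => area beta y z < 0) (c :: rest).
  move: bt cwt; rewrite ru cw_rcons !pairwise_rcons => /andP[/allP b1 b2] /andP[_ c1].
  apply/andP; split.
    by apply/allP => z /b1 h; rewrite betaE area_uvu mulr0 add0r pmulr_rlt0.
  have : pairwise (fun y z => (area b y z < 0) && (area y z a < 0)) u.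
    by rewrite pairwise_relI b2 c1.
  apply: sub_pairwise => y z /andP[h1 h2].
  by apply: comb (betaE y z) _ h1; rewrite -area_rot.
have -> : cw [:: beta, gamma, c & rest] = [&& all (fun z => area beta gamma z < 0) (c ::
    rest),
   pairwise (fun y z => area beta y z < 0) (c :: rest),
   pairwise (fun y z => area gamma y z < 0) (c :: rest) & cw (c :: rest)].
  by rewrite [in LHS]/cw -/(cw _) pairwise_cons -andbA.
rewrite gammaP betaP cwt !andbT; apply/allP => z; exact: beta_gamma.
Qed.

Lemma conv_hull_ab z : conv_hull q z -> area a b z <= 0.
Proof.
apply: conv_hull_le => [x y s|x]; last exact: ab_le0.
by rewrite !areaE !mxE; ring.
Qed.

Lemma conv_hull_bc z : conv_hull q z -> area b c z <= 0.
Proof.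
apply: conv_hull_le => [x y s|x]; last exact: bc_le0.
by rewrite !areaE !mxE; ring.
Qed.

Lemma conv_hull_mix (s : seq pt) r x y : x \in s -> y \in s -> 0 <= r <= 1 ->
  conv_hull s (mix r x y).
Proof.
move=> xs ys /andP[r0 r1]; rewrite /mix addrC.
by apply: conv_hull_convex; rewrite ?r0//; apply: mem_conv_hull.
Qed.

Lemma conv_hull_corner z : area a b z <= 0 -> area b c z <= 0 -> area c a z <= 0 ->
  conv_hull q z.
Proof.
move=> h1 h2 h3.
have : conv_hull [:: a; b; c] z.
  apply/conv_hull_natP; exists (nth 0 [:: area b c z / area a b c; tau z; area a b z /
      area a b c]).
  split.
  - by move=> [|[|[|//]]] _ /=; rewrite /tau divA_ge0.
  - by rewrite !big_ord_recr big_ord0/= add0r corner_bary1.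
  - by rewrite !big_ord_recr big_ord0/= add0r -corner_bary.
apply: sub_conv_hull => x; rewrite !inE => /or3P[]/eqP->; apply: mem_conv_hull.
- by rewrite !in_cons a_rest !orbT.
- by rewrite mem_head.
- by rewrite in_cons mem_head orbT.
Qed.

(** A point of the polygon at level [t], strictly between [a c] and [b], has
    coordinate [tau = t].  If neither of its other barycentric coordinates vanishes,
    it is interior to the triangle [a b c]; otherwise it is [beta] or [gamma]. *)
Lemma open_edges_cut d r : dotp d a = dotp d c -> dotp d a < dotp d b ->
  r = dotp d a + t * (dotp d b - dotp d a) ->
  open_edges q `&` line d r = [set beta; gamma].
Proof.
move=> dac dab rE; have A0 := corner_lt0.
have tauP z : dotp z d = r -> tau z = t.
  rewrite dotpC (cut_dotp z dac) rE => /addrI; apply: mulIf.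
  by rewrite subr_eq0 gt_eqF.
have t0 := ltW t_gt0; have t1 := ltW t_lt1; rewrite subr_ge0 in t1.
have aq : a \in q by rewrite !in_cons a_rest !orbT.
have bq : b \in q by rewrite mem_head.
have cq : c \in q by rewrite in_cons mem_head orbT.
apply/seteqP; split => [z|] /=.
  move=> [[cz /not_orP[iz /negP zq]] /tauP tz].
  have h1 := conv_hull_ab cz; have h2 := conv_hull_bc cz.
  have e := corner_bary z; have e1 := corner_bary1 z; rewrite tz in e e1.
  have [h10|h10] := eqVneq (area a b z) 0.
    left; rewrite h10 mul0r ?scale0r !addr0 in e e1.
    by rewrite e /beta /mix -e1 addrK.
  have [h20|h20] := eqVneq (area b c z) 0.
    right; rewrite h20 mul0r ?scale0r !add0r in e e1.
    by rewrite e /gamma /mix -e1 [t + _]addrC addrK addrC.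
  exfalso; apply: iz; apply: (@interior_area3 _ _ a b c).
  - by move=> y ? ? ?; apply: conv_hull_corner; apply: ltW.
  - by rewrite lt_def eq_sym h10.
  - by rewrite lt_def eq_sym h20.
  - have : 0 < tau z by rewrite tz.
    by rewrite /tau ltr_ndivlMr// mul0r.
(* A linear form that is nonpositive on the polygon and vanishes at [z] excludes
   [z] from the interior. *)
have outside (x z : pt) (y : R) (f : pt -> R) : (forall y, conv_hull q y -> f y <= 0) ->
  f z = 0 -> (forall s, f (z + s *: x) = f z + s * y) -> 0 < y ->
  ~ interior (conv_hull q) z.
  move=> fq fz fl y0 /(@interior_ray _ _ _ x)[s s0 /fq].
  by rewrite fl fz add0r leNgt mulr_gt0.
have betagamma z : z = beta \/ z = gamma -> dotp z d = r.
  by rewrite dotpC rE => -[->|->]; rewrite dotp_mix ?dac; ring.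
move=> z zE; split; last exact: betagamma.
case: zE => ->; split.
- by apply: conv_hull_mix; rewrite ?t0.
- move=> [|/=]; last by rewrite (negPf beta_notin).
  apply: (@outside (b - c) beta (- area a b c) (area a b)).
  + exact: conv_hull_ab.
  + by rewrite area_mix area_uvu area_uvv !mulr0 addr0.
  + by move=> s; rewrite !areaE !mxE; ring.
  + by rewrite oppr_gt0.
- by apply: conv_hull_mix; rewrite ?t0.
- move=> [|/=]; last by rewrite (negPf gamma_notin).
  apply: (@outside (b - a) gamma (- area a b c) (area b c)).
  + exact: conv_hull_bc.
  + by rewrite area_mix area_uvu area_uvv !mulr0 addr0.
  + by move=> s; rewrite !areaE !mxE; ring.
  + by rewrite oppr_gt0.
Qed.
End Cut.
End Corner.

(** * The loop invariant and its potential *)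

Lemma drop_minn (T : Type) k (s : seq T) : drop (minn k (size s)) s = drop k s.
Proof.
by case: leqP => // h; rewrite drop_size drop_oversize// ltnW.
Qed.

Section LoopInvariant.
Variables (R : realType) (ys : seq 'rV[R]_2).
Notation pt := 'rV[R]_2.
Implicit Types (a b c y : pt) (p q : seq pt) (S : {fset pt}) (d : pt) (r t : R).

(** The list [q] is the polygon as given by [view], and [S] the set of confirmed
vertices.  Since [q] ends at [a], the last field says that the confirmed vertices
are consecutive and end at [a]. *)
Record loop_inv q S : Prop := LoopInv {
  inv_cw : cw q;
  inv_size : (2 < size q)%N;
  inv_in : forall y, y \in ys -> forall e, e \in edges q -> area e.1 e.2 y <= 0;
  inv_touch : forall e, e \in edges q -> exists2 y, y \in ys & segment e.1 e.2 y;
  inv_sub : {subset S <= ys};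
  inv_run : exists k, S =i drop k q }.

Definition on_edge q y := exists2 e, e \in edges q & segment e.1 e.2 y.

(** The distance of a point of [Y] to confirmation: interior points have to reach an
edge, then a vertex, then [S]. *)
Definition weight q S y : nat :=
  if y \in S then 0 else if y \in q then 1 else if `[< on_edge q y >] then 2 else 3.

Definition potential q S := (\sum_(y <- ys) weight q S y)%N.

Lemma weight_leq q S q' S' y :
  (y \in S -> y \in S') -> (y \in q -> (y \in S') || (y \in q')) ->
  (on_edge q y -> (y \in S') || (y \in q') \/ on_edge q' y) ->
  (weight q' S' y <= weight q S y)%N.
Proof.
rewrite /weight => HS Hq He; case: (boolP (y \in S)) => [/HS->//|_].
case: (boolP (y \in q)) => [/Hq/orP[->//|->]|_]; first by case: ifP.
case: (asboolP (on_edge q y)) => [/He[/orP[->//|->]|he]|_].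
- by case: ifP.
- by rewrite (asboolT he); do 2?[case: ifP => //].
- by do 3?[case: ifP => //].
Qed.

Lemma potential_lt q S q' S' :
  {in ys, forall y, (weight q' S' y <= weight q S y)%N} ->
  (exists2 y, y \in ys & (weight q' S' y < weight q S y)%N) ->
  (potential q' S' < potential q S)%N.
Proof.
move=> le [y yys lt]; rewrite /potential !(big_rem y yys)/= -addSn leq_add//.
rewrite !big_seq leq_sum// => z /mem_rem; exact: le.
Qed.

Lemma eq_potential q q' S : q =i q' -> edges q =i edges q' ->
  potential q S = potential q' S.
Proof.
move=> qq' ee'; apply: eq_bigr => y _; rewrite /weight qq'.
suff -> : `[< on_edge q y >] = `[< on_edge q' y >] by [].
by apply/asboolP/asboolP => -[e h1 h2]; exists e; rewrite ?ee' // -ee'.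
Qed.

Section Corner.
Variables (b c : pt) (rest : seq pt) (S : {fset pt}).
Hypothesis rest0 : rest != [::].
Let q := [:: b, c & rest].
Let a := last c rest.
Hypothesis inv : loop_inv q S.
Hypothesis nqS : ~ q =i S.
Variables (d : pt) (r : R).
Hypothesis dac : dotp d a = dotp d c.
Hypothesis dab : dotp d a < dotp d b.
Hypothesis dr : support_value ys d r.

Let cwq : cw q := inv_cw inv.
Let tau y := area c a y / area a b c.

Let tmix t y z : tau (mix t y z) = (1 - t) * tau y + t * tau z.
Proof. exact: tau_mix. Qed.

Let tb : tau b = 1.
Proof. exact: (tau_b rest0 cwq). Qed.

Let tle0 z : z \in c :: rest -> tau z <= 0.
Proof. exact: (tau_le0 rest0 cwq). Qed.

Let edge_ab : (a, b) \in edges q.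
Proof. by rewrite edges_cons in_cons mem_rcons mem_head orbT. Qed.

Let edge_bc : (b, c) \in edges q.
Proof. by rewrite edges_cons mem_head. Qed.

Let uq : uniq q := cw_uniq (inv_size inv) cwq.

Let aq : a \in q.
Proof. by rewrite !in_cons (a_rest _ rest0) !orbT. Qed.

(** A run of consecutive vertices that ends at [a] and contains [b] is the whole
polygon. *)
Lemma run_tail : b \notin S /\ exists2 k, (k <= size (c :: rest))%N & S =i drop k (c ::
    rest).
Proof.
have [k Sk] := inv_run inv; case: k Sk => [|k] Sk; last first.
  split; last first.
    exists (minn k (size (c :: rest))); first exact: geq_minr.
    by rewrite drop_minn.
  rewrite Sk /=; apply: contraL uq => /mem_drop bin.
  by rewrite /q cons_uniq bin.
by case: nqS => y; rewrite Sk drop0.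
Qed.

Lemma support_range : dotp d a <= r <= dotp d b.
Proof.
have [[y yys yr] le] := dr; have dpos : 0 <= dotp d b - dotp d a by rewrite subr_ge0 ltW.
apply/andP; split.
  have [z /le zle [s /andP[s0 s1] zE]] := inv_touch inv edge_ab.
  apply: le_trans zle; rewrite zE dotp_mix /= -subr_ge0.
  by rewrite (_ : _ - _ = s * (dotp d b - dotp d a)) ?mulr_ge0//; ring.
rewrite -yr (cut_dotp rest0 cwq y dac).
have := corner_bary1 rest0 cwq y.
have h1 := inv_in inv yys edge_ab; have h2 := inv_in inv yys edge_bc.
rewrite -(divA_ge0 rest0 cwq) in h1; rewrite -(divA_ge0 rest0 cwq) in h2.
move: h1 h2; rewrite /= -/a; set l := _ / _; set m := _ / _; set n := _ / _.
by move=> l0 m0 s1; have n1 : n <= 1; [lra|nra].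
Qed.

(** The corner [b] is the only point of the polygon where the value at [b] is
reached, so that it belongs to [Y] and is newly confirmed. *)
Lemma keep_step : r = dotp d b -> b \in ys /\
  loop_inv (rot 1 q) (b |` S)%fset /\
  (potential (rot 1 q) (b |` S)%fset < potential q S)%N.
Proof.
move=> rE; have [bS [k kl Sk]] := run_tail.
have bys : b \in ys.
  have [[y yys yr] _] := dr; suff -> : b = y by [].
  have := corner_bary rest0 cwq y; have := corner_bary1 rest0 cwq y.
  have := cut_dotp rest0 cwq y dac; rewrite yr rE -/a.
  have h1 := inv_in inv yys edge_ab; have h2 := inv_in inv yys edge_bc.
  rewrite -(divA_ge0 rest0 cwq) in h1; rewrite -(divA_ge0 rest0 cwq) in h2.
  move: h1 h2; rewrite /= -/a; set l := _ / _; set m := _ / _; set n := _ / _.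
  move=> m0 l0 tE s1.
  have n1 : n = 1.
    apply: (mulIf (x := dotp d b - dotp d a)); first by rewrite subr_eq0 gt_eqF.
    by rewrite mul1r; lra.
  have [-> ->] : l = 0 /\ m = 0 by split; lra.
  by rewrite n1 !scale0r add0r addr0 scale1r.
split => //; split.
  split.
  - by rewrite cw_rot.
  - by rewrite size_rot (inv_size inv).
  - by move=> y yys e; rewrite edges_rot; apply: (inv_in inv).
  - by move=> e; rewrite edges_rot; apply: (inv_touch inv).
  - by move=> y; rewrite !inE => /predU1P[->//|]; apply: (inv_sub inv).
  - by exists k => y; rewrite rot1_cons drop_rcons// mem_rcons in_cons !inE Sk.
rewrite (@eq_potential (rot 1 q) q); last 2 first.
- exact: mem_rot.
- exact: edges_rot.
apply: potential_lt => [y yys|].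
  apply: weight_leq => [|->|h]; rewrite ?orbT//; last by right.
  by rewrite !inE => ->; rewrite orbT.
by exists b => //; rewrite /weight !inE eqxx (negPf bS).
Qed.

(** The edges [a b] and [b c] meet [Y], and all their points other than [a] and [c]
are beyond the answer. *)
Lemma remove_touch : r = dotp d a -> a \in ys /\ c \in ys.
Proof.
move=> rE.
have zero s : 0 <= s -> dotp d a + s * (dotp d b - dotp d a) <= r -> s = 0.
  move=> s0; rewrite rE gerDl pmulr_lle0 ?subr_gt0// => s0'.
  by apply/eqP; rewrite eq_le s0 s0'.
have [_ le] := dr; split.
  have [y yys [s /andP[s0 s1] yE]] := inv_touch inv edge_ab.
  move: (le y yys); rewrite yE dotp_mix /= => les.
  move: yE; rewrite (zero s)//= /mix ?subr0 ?scale1r ?scale0r ?addr0; first by move=> <-.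
  by apply: le_trans les; rewrite le_eqVlt; apply/orP; left; apply/eqP; ring.
have [y yys [s /andP[s0 s1] yE]] := inv_touch inv edge_bc.
move: (le y yys); rewrite yE dotp_mix /= -dac => les.
have s1' : 1 - s = 0.
  apply: zero; first by rewrite subr_ge0.
  by apply: le_trans les; rewrite le_eqVlt; apply/orP; left; apply/eqP; ring.
move: yE; rewrite /mix /= s1' scale0r add0r.
by rewrite -(subr0_eq s1') scale1r => <-.
Qed.

(** The answer leaves [Y] on the side of [a c] opposite to [b], and for a triangle
    there is nothing on that side but the segment. *)
Lemma remove_triangle : r = dotp d a -> rest = [:: a] ->
  forall y, y \in ys -> segment a c y.
Proof.
move=> rE ra y yys; have [_ /(_ y yys)] := dr.
rewrite (cut_dotp rest0 cwq y dac) rE gerDl pmulr_lle0 ?subr_gt0// => t0.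
have := corner_bary rest0 cwq y; have := corner_bary1 rest0 cwq y.
have h1 := inv_in inv yys edge_ab; have h2 := inv_in inv yys edge_bc.
have h3 : area c a y <= 0.
  by apply: (inv_in inv yys (e := (c, a))); rewrite edges_cons ra !in_cons eqxx orbT.
rewrite -(divA_ge0 rest0 cwq) in h1; rewrite -(divA_ge0 rest0 cwq) in h2.
rewrite -(divA_ge0 rest0 cwq) in h3.
move: h1 h2 h3 t0; rewrite /= -/a; set l := _ / _; set m := _ / _; set n := _ / _.
move=> l0 m0 n0 n0' s1.
have -> : n = 0 by lra.
rewrite scale0r addr0 => yE; exists l; first by lra.
by rewrite yE /mix; congr (_ *: _ + _); lra.
Qed.

(** Either [a] or [c] passes from weight 1 to weight 0. *)
Lemma remove_step : r = dotp d a -> (1 < size rest)%N ->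
  loop_inv (rot 1 (c :: rest)) (a |` (c |` S))%fset /\
  (~~ ((a \in S) && (c \in S)) ->
   potential (rot 1 (c :: rest)) (a |` (c |` S))%fset < potential q S)%N.
Proof.
move=> rE rest1; have [bS [k kl Sk]] := run_tail.
have [ays cys] := remove_touch rE; have [_ le] := dr.
have eE : edges (c :: rest) =i rcons (pairs c rest) (a, c).
  by move=> e; rewrite /= pairs_rcons.
have sub : {subset S <= (a |` (c |` S))%fset} by move=> y; rewrite !inE => ->; rewrite
    !orbT.
have pq e : e \in pairs c rest -> e \in edges q.
  by move=> h; rewrite edges_cons in_cons mem_rcons in_cons h !orbT.
have ac_seg y : y \in ys -> segment a b y \/ segment b c y -> y = a \/ y = c.
  move=> yys; have ley := le y yys; rewrite rE in ley.
  have := subr_gt0 (dotp d a) (dotp d b); rewrite dab => dpos.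
  case=> -[s /andP[s0 s1] yE]; move: ley; rewrite yE dotp_mix /= -?dac.
    have -> : (1 - s) * dotp d a + s * dotp d b = dotp d a + s * (dotp d b - dotp d a) by
        ring.
    rewrite gerDl pmulr_lle0// => s0'; left.
    have -> : s = 0 by lra.
    by rewrite /mix subr0 scale1r scale0r addr0.
  have -> : (1 - s) * dotp d b + s * dotp d a = dotp d a + (1 - s) * (dotp d b - dotp d
      a) by ring.
  rewrite gerDl pmulr_lle0// => s0'; right.
  have -> : s = 1 by lra.
  by rewrite /mix subrr scale1r scale0r add0r.
split.
  split.
  - by rewrite cw_rot; case/andP: cwq.
  - by rewrite size_rot.
  - move=> y yys e; rewrite edges_rot eE mem_rcons in_cons => /predU1P[->|/pq].
      have := le y yys; rewrite (cut_dotp rest0 cwq y dac) rE gerDl.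
      rewrite pmulr_lle0 ?subr_gt0// ler_ndivrMr ?corner_lt0// mul0r -/a /= => h.
      have -> : area a c y = - area c a y by rewrite !areaE; ring.
      by rewrite oppr_le0.
    exact: (inv_in inv).
  - move=> e; rewrite edges_rot eE mem_rcons in_cons => /predU1P[->|/pq].
      exists a => //; exists 0; first by rewrite lexx ler01.
      by rewrite /mix subr0 scale1r scale0r addr0.
    exact: (inv_touch inv).
  - by move=> y; rewrite !inE => /or3P[/eqP->|/eqP->|]//; apply: (inv_sub inv).
  - rewrite rot1_cons; case: k {kl} Sk => [|k] Sk.
      exists 0%N => y; rewrite drop0 !inE Sk drop0 mem_rcons in_cons.
      by case: eqVneq => [->|]; rewrite ?(a_rest _ rest0) ?orbT//= orbA orbb.
    have [u ru] : exists u, rest = rcons u a.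
      by rewrite /a; case/lastP: (rest) rest0 => // u x _; exists u; rewrite last_rcons.
    have mA y : (y \in (a |` (c |` S))%fset) = [|| y == a, y == c | y \in drop k (rcons u
        a)].
      by rewrite !inE Sk /= ru.
    have [ku|ku] := leqP k (size u); [exists k|exists (size u)] => y; rewrite mA ru.
      rewrite !drop_rcons ?size_rcons ?leqW// !mem_rcons !in_cons mem_rcons in_cons.
      by case: (y == a); case: (y == c).
    rewrite (@drop_oversize _ k (rcons u a)) ?size_rcons// !drop_rcons ?size_rcons//.
    by rewrite drop_size/= !inE orbF orbC.
move=> nac; rewrite (@eq_potential (rot 1 (c :: rest)) (c :: rest)); last 2 first.
- exact: mem_rot.
- exact: edges_rot.
apply: potential_lt => [y yys|].
  apply: weight_leq => [/sub//||].
    rewrite in_cons => /predU1P[yb|->]; last by rewrite orbT.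
    by have := le y yys; rewrite yb rE leNgt dab.
  move=> [e]; rewrite edges_cons in_cons mem_rcons in_cons.
  case/predU1P => [->|/predU1P[->|ein]] seg.
  - by left; rewrite !inE; case: (ac_seg y yys) => [|->|->]; [right| |]; rewrite ?eqxx
      ?orbT.
  - by left; rewrite !inE; case: (ac_seg y yys) => [|->|->]; [left| |]; rewrite ?eqxx ?orbT.
  - by right; exists e => //; rewrite eE mem_rcons in_cons ein orbT.
have wz z : z \in q -> z \notin S -> z \in (a |` (c |` S))%fset ->
   (weight (c :: rest) (a |` (c |` S))%fset z < weight q S z)%N.
  by rewrite /weight => -> /negPf -> ->.
move: nac; rewrite negb_and => /orP[zS|zS]; [exists a|exists c] => //.
  by apply: wz => //; rewrite !inE eqxx.
by apply: wz => //; rewrite !inE ?eqxx ?orbT.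
Qed.

(** A point [y0] of [Y] giving the answer ends up on the new edge.  It was not a
vertex.  If it was on an edge, then it was on [a b] or [b c] and it becomes one of
the two new vertices; otherwise it was interior.  In both cases its weight
drops. *)
Lemma cut_step t : 0 < t < 1 -> r = dotp d a + t * (dotp d b - dotp d a) ->
  loop_inv [:: mix t a b, mix t c b, c & rest] S /\
  (potential [:: mix t a b, mix t c b, c & rest] S < potential q S)%N.
Proof.
move=> /[dup] t01 /andP[t0 t1] rE; have [bS [k kl Sk]] := run_tail.
have [[y0 y0ys y0r] le] := dr; have A0 := corner_lt0 rest0 cwq.
have dpos : 0 < dotp d b - dotp d a by rewrite subr_gt0.
have tau_le y : y \in ys -> tau y <= t.
  move=> /le; rewrite (cut_dotp rest0 cwq y dac) rE lerD2l ler_pM2r//.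
have tau0 : tau y0 = t.
  move: y0r; rewrite (cut_dotp rest0 cwq y0 dac) rE => /addrI; apply: mulIf.
  by rewrite gt_eqF.
(* The edges are those of the old polygon, except for the three edges at the new
   vertices. *)
set q' := [:: _, _, c & rest].
have eE : edges q' = [:: (mix t a b, mix t c b), (mix t c b, c) &
    rcons (pairs c rest) (a, mix t a b)] by rewrite edges_cons.
have pq e : e \in pairs c rest -> e \in edges q.
  by move=> h; rewrite edges_cons in_cons mem_rcons in_cons h !orbT.
have rescale s : 0 <= s <= t -> 0 <= s / t <= 1.
  by move=> /andP[s0 st]; rewrite divr_ge0 ?(ltW t0)//= ler_pdivrMr// mul1r.
have tn0 : t != 0 by rewrite gt_eqF.
have tau_ab s : tau (mix s a b) = s.
  by rewrite tmix tb /tau area_uvv mul0r mulr0 add0r mulr1.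
have tau_bc s : tau (mix s b c) = 1 - s.
  by rewrite tmix tb /tau area_uvu mul0r mulr0 addr0 mulr1.
have seg_ab y : y \in ys -> segment a b y -> segment a (mix t a b) y.
  move=> yys [s /andP[s0 s1] yE]; exists (s / t).
    by apply: rescale; rewrite s0 -(tau_ab s) -yE tau_le.
  by rewrite yE; apply/pt_eqP; rewrite !mxE; split; field.
have seg_bc y : y \in ys -> segment b c y -> segment (mix t c b) c y.
  move=> yys [s /andP[s0 s1] yE]; exists (1 - (1 - s) / t).
    have := rescale (1 - s); rewrite subr_ge0 s1 -(tau_bc s) -yE tau_le// => /(_ isT).
    by move=> /andP[h1 h2]; rewrite subr_ge0 h2 gerBl h1.
  by rewrite yE; apply/pt_eqP; rewrite !mxE; split; field.
have seg_bg y : y \in ys -> tau y = t -> segment (mix t a b) (mix t c b) y.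
  move=> yys ty; have := corner_bary rest0 cwq y; have := corner_bary1 rest0 cwq y.
  have h1 := inv_in inv yys edge_ab; have h2 := inv_in inv yys edge_bc.
  rewrite -(divA_ge0 rest0 cwq) in h1; rewrite -(divA_ge0 rest0 cwq) in h2.
  move: h1 h2; rewrite /= -/a -/(tau y) ty; set l := _ / _; set m := _ / _.
  move=> l0 m0 s1 yE; have t1n : 1 - t != 0 by rewrite subr_eq0 gt_eqF.
  exists (l / (1 - t)).
    rewrite divr_ge0 ?subr_ge0 ?(ltW t1)//= ler_pdivrMr ?subr_gt0// mul1r; lra.
  by rewrite yE (_ : m = 1 - t - l); [apply/pt_eqP; rewrite !mxE; split; field|lra].
split.
  split.
  - exact: (cw_cut rest0 cwq).
  - by rewrite /q'/=; case: (rest) rest0.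
  - move=> y yys e; rewrite eE !in_cons mem_rcons in_cons.
    have hab := inv_in inv yys edge_ab; have hbc := inv_in inv yys edge_bc.
    move=> /or4P[/eqP->|/eqP->|/eqP->|/pq]/=; last exact: (inv_in inv).
    + have -> : area (mix t a b) (mix t c b) y = (1 - t) * (t * area a b c - area c a y).
        by rewrite !areaE !mxE; ring.
      rewrite pmulr_rle0 ?subr_gt0// subr_le0.
      by have := tau_le y yys; rewrite /tau ler_ndivrMr.
    + have -> : area (mix t c b) c y = t * area b c y by rewrite !areaE !mxE; ring.
      by rewrite pmulr_rle0.
    + have -> : area a (mix t a b) y = t * area a b y by rewrite !areaE !mxE; ring.
      by rewrite pmulr_rle0.
  - move=> e; rewrite eE !in_cons mem_rcons in_cons.
    move=> /or4P[/eqP->|/eqP->|/eqP->|/pq]/=; last exact: (inv_touch inv).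
    + by exists y0 => //; apply: seg_bg.
    + by have [y yys sy] := inv_touch inv edge_bc; exists y => //; apply: seg_bc.
    + by have [y yys sy] := inv_touch inv edge_ab; exists y => //; apply: seg_ab.
  - exact: inv_sub inv.
  - by exists k.+2.
have nb y : y \in ys -> y != b.
  by move=> yys; apply/eqP => yb; have := tau_le y yys; rewrite yb tb leNgt t1.
apply: potential_lt => [y yys|].
  apply: weight_leq => // [|[e]].
    by rewrite in_cons (negPf (nb y yys)) => /= h; rewrite /q' 2!in_cons h !orbT.
  rewrite edges_cons in_cons mem_rcons in_cons => /or3P[/eqP->|/eqP->|ein] seg; right.
  - by exists (mix t c b, c); [rewrite eE !in_cons eqxx orbT|apply: seg_bc].
  - by exists (a, mix t a b); [rewrite eE !in_cons mem_rcons mem_head !orbT|apply: seg_ab].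
  - by exists e => //; rewrite eE !in_cons mem_rcons in_cons ein !orbT.
exists y0 => //.
have y0q : y0 \notin q.
  rewrite in_cons negb_or nb//=; apply/negP => /tle0.
  by rewrite -/a -/(tau y0) tau0 leNgt t0.
have y0S : y0 \notin S.
  by apply: contra y0q; rewrite Sk => /mem_drop h; rewrite in_cons h orbT.
rewrite /weight (negPf y0S) (negPf y0q).
case: (asboolP (on_edge q y0)) => [[e]|_]; last first.
  rewrite (_ : `[< on_edge q' y0 >]); first by case: ifP.
  by apply/asboolP; exists (mix t a b, mix t c b); [rewrite eE mem_head|apply: seg_bg].
suff yq' : segment a b y0 \/ segment b c y0 -> y0 \in q'.
  rewrite edges_cons in_cons mem_rcons in_cons => /or3P[/eqP->|/eqP->|ein] seg.
  - by rewrite yq'//; right.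
  - by rewrite yq'//; left.
  have [e1 e2] := mem_pairs ein; case: seg => s /andP[s0 s1] yE.
  have h1 : (1 - s) * tau e.1 <= 0 by rewrite mulr_ge0_le0 ?subr_ge0 ?tle0.
  have h2 : s * tau e.2 <= 0 by rewrite mulr_ge0_le0// tle0// in_cons e2 orbT.
  by move: t0; rewrite -tau0 yE tmix; lra.
move=> [] [s _ yE]; rewrite !in_cons.
  by have -> : y0 = mix t a b; [rewrite -tau0 [in tau _]yE tau_ab -yE|rewrite eqxx].
have -> : y0 = mix t c b; last by rewrite eqxx orbT.
rewrite -tau0 {2}yE tau_bc yE; apply/pt_eqP; rewrite !mxE; split; ring.
Qed.

End Corner.

(** A fully confirmed polygon has at least three vertices, and [Y] has at most
three. *)
Lemma inv_exit q S : reduced ys -> (size ys <= 3)%N -> loop_inv q S ->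
  q =i S \/ (2 < #|` S|)%N -> S =i ys.
Proof.
move=> [uys _] ys3 inv H; have S3 : (2 < size S)%N.
  case: H => // qS; apply: leq_trans (inv_size inv) _.
  by apply: uniq_leq_size => [|y]; rewrite ?qS// (cw_uniq (inv_size inv) (inv_cw inv)).
have [] := uniq_min_size (fset_uniq S) (inv_sub inv); last by [].
exact: leq_trans ys3 S3.
Qed.

End LoopInvariant.

(** * The loop of the planar algorithm *)

Section PlanarLoop.
Variables (R : realType) (ys : seq 'rV[R]_2) (ask : 'rV[R]_2 -> R -> Prop).
Notation pt := 'rV[R]_2.
Hypothesis ys_reduced : reduced ys.
Hypothesis ys_small : (size ys <= 3)%N.
Hypothesis ask_exists : forall d, exists r, ask d r.
Hypothesis ask_support : forall d r, ask d r -> support_value ys d r.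
Notation step := (planar_step ask 3).
Implicit Types (a b c y d : pt) (p q : seq pt) (S : {fset pt}) (r t : R).

Definition planar_result (c : planar_conf R) :=
  exists2 S : {fset pt}, c = PDone S & S =i ys.

Lemma halted_done S : halted step (PDone S).
Proof. by move=> m c' st; inversion st. Qed.

Lemma planar_exit p S i B : ~ loop_cond 3 p S -> S =i ys ->
  terminates_within step planar_result (PLoop p S i) B.
Proof.
move=> nl Sys; apply: terminates_within_intro; first by exists 0%N, (PDone S); apply: PExit.
move=> m c' st; inversion st; subst => //.
exists B => //; apply: within_final; [exact: halted_done|by exists S].
Qed.

Lemma eq_open_edges p q : p =i q -> open_edges p = open_edges q.
Proof.
move=> pq; rewrite /open_edges (eq_conv_hull pq).
by congr (_ `\` (_ `|` _)); apply/seteqP; split => y /=; rewrite pq.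
Qed.

Lemma eq_clockwise p k : clockwise p <-> uniq (rot k p) /\ cw (rot k p).
Proof. by rewrite rot_uniq cw_rot; exact: clockwiseP. Qed.

Section Step.
Variables (p : seq pt) (i : nat) (b c : pt) (rest : seq pt) (S : {fset pt}).
Hypothesis rest0 : rest != [::].
Let q := [:: b, c & rest].
Let a := last c rest.
Hypothesis pq : view p i = q.
Hypothesis inv : loop_inv ys q S.
Hypothesis cond : loop_cond 3 p S.

Let p0 : p != [::].
Proof. by rewrite -size_eq0 -(size_view p i) pq. Qed.

Lemma cyc_a : cyc p i = a.
Proof. by rewrite cyc_last// pq. Qed.

Lemma cyc_b : cyc p i.+1 = b.
Proof. by rewrite -[i.+1]addn0 cyc_view ?pq// -(size_view p i) pq. Qed.

Lemma cyc_c : cyc p i.+2 = c.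
Proof. by rewrite -[i.+2]addn1 cyc_view ?pq// -(size_view p i) pq. Qed.

Let mem_p : p =i q.
Proof. by move=> y; rewrite -pq mem_view. Qed.

Let nqS : ~ q =i S.
Proof. by move=> qS; case: cond => + _; apply=> y; rewrite mem_p. Qed.

Let cwq := inv_cw inv.
Let uq : uniq q := cw_uniq (inv_size inv) cwq.

Let bNtail : b \notin c :: rest.
Proof. by move: uq; rewrite /q cons_uniq => /andP[]. Qed.

Let mem_tail y : (y \in [seq y <- p | y != b]) = (y \in c :: rest).
Proof.
rewrite mem_filter mem_p in_cons; case: eqVneq => [->|//].
by rewrite (negPf bNtail).
Qed.

Let cutE r d : dotp d a = dotp d c -> dotp d a < dotp d b -> support_value ys d r ->
  r <> dotp d b -> r <> dotp d a -> exists2 t, 0 < t < 1 &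
  r = dotp d a + t * (dotp d b - dotp d a).
Proof.
move=> dac dab dr rb ra; have /andP[r0 r1] := support_range rest0 inv dac dab dr.
have dpos : 0 < dotp d b - dotp d a by rewrite subr_gt0.
exists ((r - dotp d a) / (dotp d b - dotp d a)).
  have ra' : dotp d a < r by rewrite lt_neqAle r0 andbT; apply/eqP => /esym.
  have rb' : r < dotp d b by rewrite lt_neqAle r1 andbT; apply/eqP.
  by rewrite divr_gt0 ?subr_gt0//= ltr_pdivrMr// mul1r ltrD2r.
by rewrite divfK ?gt_eqF// addrC subrK.
Qed.

(** The program only prescribes the set of new vertices and the place of [a]; the
clockwise order determines everything else. *)
Lemma view_cut t p' : 0 < t < 1 -> clockwise p' ->
  p' =i [:: mix t a b, mix t c b & [seq y <- p | y != b]] -> cyc p' i = a ->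
  view p' i = [:: mix t a b, mix t c b, c & rest].
Proof.
move=> t01 /(eq_clockwise _ (i.+1 %% size p')); rewrite -/(view p' i) => -[up' cp'].
move=> mp' ca; have p'0 : p' != [::].
  by case: p' mp' {up' cp' ca} => // /(_ (mix t a b)); rewrite in_nil in_cons eqxx.
have cq' := cw_cut rest0 cwq t01; have uq' : uniq [:: mix t a b, mix t c b, c & rest] by
    exact: cw_uniq cq'.
rewrite cyc_last// in ca; have mv : view p' i =i [:: mix t a b, mix t c b, c & rest].
  by move=> y; rewrite mem_view mp' !in_cons mem_tail in_cons.
move: cq' uq' mv up' cp' ca.
rewrite (_ : [:: mix t a b, mix t c b, c & rest] =
   rcons [:: mix t a b, mix t c b & belast c rest] a); last first.
  by rewrite -(cat1s (mix t a b)) -(cat1s (mix t c b)) (lastI c rest).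
case/lastP: (view p' i) => [|s x]; first by move=> _ _ /(_ a); rewrite mem_rcons mem_head.
rewrite last_rcons => cq' uq' mv up' cp' xa; rewrite xa in mv up' cp' *.
by rewrite (cw_inj_last cp' cq' up' uq' mv).
Qed.

Lemma view_remove p' : clockwise p' -> p' =i [seq y <- p | y != b] ->
  cyc p' i.+1 = c -> view p' i = c :: rest.
Proof.
move=> /(eq_clockwise _ (i.+1 %% size p')); rewrite -/(view p' i) => -[up' cp'].
move=> mp' cc; have sp' : (0 < size p')%N.
  by case: p' mp' {up' cp' cc} => // /(_ c); rewrite mem_tail in_nil in_cons eqxx.
have mv : view p' i =i c :: rest by move=> y; rewrite mem_view mp' mem_tail.
have : (view p' i)`_0 = c by rewrite -cyc_view// addn0.
have : (0 < size (view p' i))%N by rewrite size_view.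
have ct : cw (c :: rest) by case/andP: cwq.
have ut : uniq (c :: rest) by move: uq; rewrite /q cons_uniq => /andP[].
case: (view p' i) up' cp' mv => // x s /= up' cp' mv _ xc; rewrite xc in up' cp' mv *.
by rewrite (cw_inj cp' ct up' ut mv).
Qed.

(** A list in convex position on the segment [a c] that contains [a] and [c]
    contains nothing else. *)
Lemma remove_triangle_done p' d r : dotp d a = dotp d c -> dotp d a < dotp d b ->
  support_value ys d r -> r = dotp d a -> rest = [:: a] ->
  p' =i [seq y <- p | y != b] ->
  [/\ (size ys < 3)%N, ~ loop_cond 3 p' (a |` (c |` S))%fset & (a |` (c |` S))%fset =i ys].
Proof.
move=> dac dab sr ra re mp'.
have [ays cys] := remove_touch inv dac dab sr ra.
have seg := remove_triangle rest0 inv dac dab sr ra re.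
have ysac : {subset ys <= [:: a; c]}.
  apply: reduced_sub => //; apply/seteqP; split; apply: sub_conv_hull => y.
    move=> /seg[t t01 ->]; apply: conv_hull_mix => //; by rewrite !inE eqxx ?orbT.
  by rewrite !inE => /orP[]/eqP->; apply: mem_conv_hull.
have SE : (a |` (c |` S))%fset =i ys.
  move=> y; rewrite !inE; apply/idP/idP => [/or3P[/eqP->|/eqP->|/(inv_sub inv)]//|/ysac].
  by rewrite !inE => /orP[]->; rewrite ?orbT.
split => //; first by apply: (@uniq_leq_size _ _ [:: a; c]) => //; case: ys_reduced.
case=> + _; apply=> y; rewrite mp' mem_tail SE re !inE.
apply/idP/idP => [/orP[]/eqP->//|/ysac]; by rewrite !inE orbC.
Qed.

Lemma loop_progress : exists m cf, step (PLoop p S i) m cf.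
Proof.
have [d dac dab] := cut_direction_exists rest0 cwq.
have cd : cut_direction p i d by split; rewrite cyc_a ?cyc_b ?cyc_c.
have [r dr] := ask_exists d; have sr := ask_support dr.
exists 1%N; have [rb|rb] := pselect (r = dotp d b).
  by eexists; apply: (PKeep cond cd dr); rewrite cyc_b.
have [ra|ra] := pselect (r = dotp d a).
  have [p' sp' vp'] := view_surj (c :: rest) i.
  eexists; apply: (@PRemove _ ask 3 p S i d r p') => //.
  - by rewrite cyc_a.
  - apply/(eq_clockwise p' (i.+1 %% size p')).
    rewrite -/(view p' i) vp'; split; first by case/andP: uq.
    by case/andP: cwq.
  - by move=> y; rewrite cyc_b mem_tail -vp' mem_view.
  - by rewrite cyc_last ?vp' ?cyc_a// -size_eq0 sp'.
  - by rewrite cyc_c -[i.+1]addn0 cyc_view ?vp'// sp'.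
have [t t01 rE] := cutE dac dab sr rb ra.
have [p' sp' vp'] := view_surj [:: mix t a b, mix t c b, c & rest] i.
exists (PLoop p' S i); apply: (@PCut _ ask 3 p S i d r (mix t a b) (mix t c b) p') => //.
- by rewrite cyc_b.
- by rewrite cyc_a.
- by rewrite (eq_open_edges mem_p) (open_edges_cut rest0 cwq t01 dac dab rE).
- apply/(eq_clockwise p' (i.+1 %% size p')).
  rewrite -/(view p' i) vp'; have h := cw_cut rest0 cwq t01.
  by split => //; apply: cw_uniq h.
- by move=> y; rewrite -(mem_view p' i) vp' cyc_b !in_cons mem_tail in_cons.
- by rewrite cyc_last ?vp' ?cyc_a// -size_eq0 sp'.
- by have := @cyc_view _ p' i 0; have := @cyc_view _ p' i 1;
  rewrite vp' sp' addn0 addn1 => /(_ isT) -> /(_ isT) ->.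
Qed.

(** The last alternative is the removal that turns a triangle into a segment: it
may confirm nothing new, but [Y] has then at most two vertices. *)
Lemma loop_step m cf : step (PLoop p S i) m cf -> m = 1%N /\
  exists p' S' i', cf = PLoop p' S' i' /\
   ((loop_inv ys (view p' i') S' /\ (potential ys (view p' i') S' < potential ys q S)%N) \/
    [/\ (size ys < 3)%N, ~ loop_cond 3 p' S' & S' =i ys]).
Proof.
move=> st; inversion st as [| |? ? ? nl|p1 S1 i1 d r _ [dac dab] dr rE
  |p1 S1 i1 d r p' _ [dac dab] dr rE cp' mp' ca cc
  |p1 S1 i1 d r b' c1 p' _ [dac dab] dr rb ra oe cp' mp' ca _]; subst => //.
- rewrite cyc_a cyc_c in dac; rewrite cyc_a cyc_b in dab; rewrite cyc_b in dr *.
  split => //; exists p, (b |` S)%fset, i.+1; split => //; left.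
  rewrite viewS pq.
  by have [_] := keep_step rest0 inv nqS dac dab (ask_support dr) erefl.
- rewrite cyc_a cyc_c in dac; rewrite cyc_a cyc_b in dab; rewrite cyc_a in dr ca *.
  rewrite cyc_b in mp'; rewrite cyc_c in cc *.
  split => //; exists p', (a |` (c |` S))%fset, i.+1; split => //.
  have [rest1|] := leqP 2 (size rest); last first.
    move=> srest; right; have re : rest = [:: a].
      by rewrite /a; case: (rest) rest0 srest => [|x [|]].
    exact: remove_triangle_done dac dab (ask_support dr) erefl re mp'.
  left; rewrite viewS (view_remove cp' mp' cc).
  have [inv' lt] := remove_step rest0 inv nqS dac dab (ask_support dr) erefl rest1.
  split => //; apply: lt; apply/negP => /andP[_ cS].
  have [_ [k _ Sk]] := run_tail inv nqS.
  case: k Sk => [|k] Sk.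
    have : (size (c :: rest) <= #|` S|)%N.
      apply: uniq_leq_size => [|y]; last by rewrite Sk drop0.
      by move: uq; rewrite /q cons_uniq => /andP[].
    by case: cond => _ S3 /leq_trans/(_ S3)/=; rewrite !ltnS leqNgt rest1.
  move: cS; rewrite Sk /= => /mem_drop cr.
  by move: uq; rewrite /q /= cr andbF.
- rewrite cyc_a cyc_c in dac; rewrite cyc_a cyc_b in dab; rewrite cyc_a in ra ca.
  rewrite cyc_b in rb mp'.
  have [t t01 rE] := cutE dac dab (ask_support dr) rb ra.
  split => //; exists p', S, i; split => //; left.
  have -> : view p' i = [:: mix t a b, mix t c b, c & rest]; last first.
    exact: (cut_step rest0 inv nqS dac dab (ask_support dr) t01 rE).
  apply: view_cut => // y.
  move: oe; rewrite (eq_open_edges mem_p) (open_edges_cut rest0 cwq t01 dac dab rE) => oe.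
  rewrite mp' !in_cons !orbA; congr (_ || _); apply/idP/idP.
    move=> h; have : [set b'; c1] y by case/orP: h => /eqP->; [left|right].
    by rewrite oe => -[->|->]; rewrite eqxx ?orbT.
  move=> h; have : [set mix t a b; mix t c b] y by case/orP: h => /eqP->; [left|right].
  by rewrite -oe => -[->|->]; rewrite eqxx ?orbT.
Qed.

End Step.

(** The additional call for fewer than three vertices pays for a final removal
which confirms nothing new. *)
Lemma planar_loop p S i B : loop_inv ys (view p i) S ->
  (potential ys (view p i) S + (size ys < 3) <= B)%N ->
  terminates_within step planar_result (PLoop p S i) B.
Proof.
have [n] := ubnP B; elim: n B p S i => // n IH B p S i Bn inv le.
have [cond|ncond] := pselect (loop_cond 3 p S); last first.
  apply: planar_exit => //; apply: (inv_exit ys_reduced ys_small inv).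
  have [S3|S3] := leqP 3 #|` S|; [by right|left].
  apply: contrapT => nvS; apply: ncond; split => // pS; apply: nvS => y.
  by rewrite mem_view pS.
have := inv_size inv; move: (inv); case vE : (view p i) => [|b [|c rest]]// inv' sz.
have rest0 : rest != [::] by case: rest sz {vE inv'}.
apply: terminates_within_intro; first exact: loop_progress rest0 vE inv' cond.
move=> m c' /(loop_step rest0 vE inv' cond)[->] [p' [S' [i' [-> [[inv1 lt]|]]]]].
  have Bpos : (0 < B)%N by rewrite vE in le; lia.
  by exists B.-1; rewrite ?add1n ?prednK//; apply: IH inv1 _; rewrite vE in le; lia.
move=> [ys2 ncond' S'ys]; exists B.-1; last exact: planar_exit.
by rewrite add1n prednK//; move: le; rewrite ys2 addn1; apply: leq_trans.
Qed.

End PlanarLoop.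

(** * The initial triangle and rectangle *)

Section InitialPotential.
Variables (R : realType) (ys : seq 'rV[R]_2).
Notation pt := 'rV[R]_2.
Implicit Types (p q : seq pt) (y : pt).

Lemma weight_leq3 q y : (weight q fset0 y <= 3)%N.
Proof. by rewrite /weight inE; case: ifP => //; case: ifP. Qed.

Lemma weight_edge q y : on_edge q y -> (weight q fset0 y <= 2)%N.
Proof. by move=> /asboolP h; rewrite /weight inE h; case: ifP. Qed.

Lemma weight_vertex q y : y \in q -> (weight q fset0 y <= 1)%N.
Proof. by rewrite /weight inE => ->. Qed.

(** Double counting of the incidences between the points of [Y] and the sides [E] of
the polygon. *)
Lemma potential_tight q (E : seq (pred pt)) :
  (forall y, y \in ys -> weight q fset0 y + count (fun e : pred pt => e y) E <= 3)%N ->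
  all (fun e => has e ys) E -> (potential ys q fset0 + size E <= 3 * size ys)%N.
Proof.
move=> wE hE.
have -> : (3 * size ys = \sum_(y <- ys) 3)%N.
  by rewrite big_const_seq count_predT iter_addn_0.
apply: (@leq_trans (\sum_(y <- ys) (weight q fset0 y + count (fun e : pred pt => e y)
    E))%N); last first.
  by rewrite !big_seq leq_sum// => y; apply: wE.
rewrite big_split leq_add2l/=.
elim: E hE {wE} => [//|e E IH] /= /andP[he hE].
rewrite big_split/= -add1n; apply: leq_add; last exact: IH.
by rewrite -big_mkcond/= sum1_count -has_count in he *.
Qed.

Lemma loop_inv_start p q : clockwise p -> p =i q -> cw q -> uniq q -> (2 < size q)%N ->
  (forall y, y \in ys -> forall e, e \in edges q -> area e.1 e.2 y <= 0) ->
  (forall e, e \in edges q -> exists2 y, y \in ys & segment e.1 e.2 y) ->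
  loop_inv ys (view p 0) fset0 /\ potential ys (view p 0) fset0 = potential ys q fset0.
Proof.
move=> /clockwiseP[up cp] pq cq uq q3 hin htouch.
have eE : edges (view p 0) =i edges q.
  by move=> e; rewrite edges_rot; apply: eq_edges_cw.
have vq : view p 0 =i q by move=> y; rewrite mem_view pq.
split; last exact: eq_potential.
split.
- by rewrite cw_rot.
- by rewrite size_view (eqP (_ : size p == size q))// -uniq_size_uniq.
- by move=> y yys e; rewrite eE; apply: hin.
- by move=> e; rewrite eE; apply: htouch.
- by move=> y; rewrite inE.
- by exists (size (view p 0)) => y; rewrite drop_size inE.
Qed.

End InitialPotential.

Section InitialPolygons.
Variable R : realType.
Notation pt := 'rV[R]_2.
Implicit Types (A B C l u r s t : R) (x y z : pt).

Definition xy s t : pt := \row_i (if i == 0 then s else t).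

Lemma xy0 s t : xy s t 0 0 = s. Proof. by rewrite mxE. Qed.
Lemma xy1 s t : xy s t 0 1 = t. Proof. by rewrite mxE. Qed.

Lemma eq_xy y s t : y 0 0 = s -> y 0 1 = t -> y = xy s t.
Proof. by move=> y0 y1; apply/pt_eqP; rewrite xy0 xy1. Qed.

Lemma convex_max t r s s' : 0 < t < 1 -> t * s + (1 - t) * s' = r -> s <= r ->
  s' <= r -> s = r /\ s' = r.
Proof. by move=> /andP[t0 t1] e xr yr; split; nra. Qed.

Section Triangle.
Variables (A B C : R).
Let T : set pt := [set y | [/\ y 0 0 <= A, y 0 1 <= B & - y 0 0 - y 0 1 <= C]].
Hypothesis ABC : 0 < A + B + C.
Let p1 := xy A B.
Let p2 := xy A (- A - C).
Let p3 := xy (- B - C) B.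
Definition triangle := [:: p1; p2; p3].

Lemma cw_triangle : cw triangle.
Proof.
rewrite /= !andbT areaE !xy0 !xy1.
by have := exprn_gt0 2 ABC; lra.
Qed.

Lemma vertices_triangle : vertices T = [set` triangle].
Proof.
have abc := ABC.
apply/seteqP; split => v.
  suff -> : T = conv_hull triangle by exact: vertices_conv_hull_sub.
  apply/seteqP; split => y.
    move=> [h1 h2 h3]; apply: (@conv_hull_corner _ p1 p2 [:: p3] isT cw_triangle).
    - by rewrite /= areaE !xy0 !xy1; nra.
    - by rewrite /= areaE !xy0 !xy1; nra.
    - by rewrite /= areaE !xy0 !xy1; nra.
  apply: conv_hull_min => [x z t [x1 x2 x3] [z1 z2 z3] /andP[t0 t1]|x].
    by rewrite /T /= !mxE; split; nra.
  by rewrite !inE => /or3P[]/eqP->; rewrite /T /= !xy0 !xy1; split; lra.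
rewrite /= !inE => /or3P[]/eqP->; (split=> [|x y t [x1 x2 x3] [y1 y2 y3] t01]).
all: try by rewrite /T /= !xy0 !xy1; split; lra.
all: move=> /pt_eqP; rewrite !mxE !eqxx /= => -[e0 e1].
- have [h1 h2] := convex_max t01 (esym e0) x1 y1.
  have [h3 h4] := convex_max t01 (esym e1) x2 y2.
  by split; apply: eq_xy.
- have [h1 h2] := convex_max t01 (esym e0) x1 y1.
  have [|h3 h4] := convex_max (r := C) t01 _ x3 y3.
    by transitivity (- (t * x 0 0 + (1 - t) * y 0 0) - (t * x 0 1 + (1 - t) * y 0 1));
      [ring|rewrite -e0 -e1; ring].
  by split; apply: eq_xy => //; lra.
- have [h1 h2] := convex_max t01 (esym e1) x2 y2.
  have [|h3 h4] := convex_max (r := C) t01 _ x3 y3.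
    by transitivity (- (t * x 0 0 + (1 - t) * y 0 0) - (t * x 0 1 + (1 - t) * y 0 1));
      [ring|rewrite -e0 -e1; ring].
  by split; apply: eq_xy => //; lra.
Qed.

Lemma triangle_edge12 y : T y -> y 0 0 = A -> segment p1 p2 y.
Proof.
have abc := ABC.
move=> [h1 h2 h3] e; exists ((B - y 0 1) / (A + B + C)).
  rewrite divr_ge0 ?(ltW ABC) ?subr_ge0//= ler_pdivrMr// mul1r; lra.
have n0 : A + B + C != 0 by rewrite gt_eqF.
by apply/pt_eqP; rewrite !mxE !eqxx /=; split; rewrite ?e; field.
Qed.

Lemma triangle_edge23 y : T y -> - y 0 0 - y 0 1 = C -> segment p2 p3 y.
Proof.
have abc := ABC.
move=> [h1 h2 h3] e; exists ((A - y 0 0) / (A + B + C)).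
  rewrite divr_ge0 ?(ltW ABC) ?subr_ge0//= ler_pdivrMr// mul1r; lra.
have n0 : A + B + C != 0 by rewrite gt_eqF.
by apply/pt_eqP; rewrite !mxE !eqxx /=; split; rewrite -e; field; rewrite e.
Qed.

Lemma triangle_edge31 y : T y -> y 0 1 = B -> segment p3 p1 y.
Proof.
have abc := ABC.
move=> [h1 h2 h3] e; exists ((y 0 0 + B + C) / (A + B + C)).
  rewrite divr_ge0 ?(ltW ABC)//=; last lra.
  rewrite ler_pdivrMr// mul1r; lra.
have n0 : A + B + C != 0 by rewrite gt_eqF.
by apply/pt_eqP; rewrite !mxE !eqxx /=; split; rewrite ?e; field.
Qed.

Variable ys : seq pt.
Hypothesis ysT : forall y, y \in ys -> T y.
Hypothesis tight1 : exists2 y, y \in ys & y 0 0 = A.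
Hypothesis tight2 : exists2 y, y \in ys & y 0 1 = B.
Hypothesis tight3 : exists2 y, y \in ys & - y 0 0 - y 0 1 = C.

Lemma potential_triangle : (potential ys triangle fset0 + 3 <= 3 * size ys)%N.
Proof.
have abc := ABC.
pose E : seq (pred pt) := [:: (fun y => y 0 0 == A); (fun y => y 0 1 == B) ;
  (fun y => - y 0 0 - y 0 1 == C)].
apply: (@potential_tight _ ys triangle E); last first.
  rewrite /E /= andbT; apply/and3P; split; apply/hasP.
  - by have [y yys /eqP] := tight1; exists y.
  - by have [y yys /eqP] := tight2; exists y.
  - by have [y yys /eqP] := tight3; exists y.
move=> y yys; have Ty := ysT yys; rewrite /E /= addn0.
have [e1|n1] := eqVneq (y 0 0) A; have [e2|n2] := eqVneq (y 0 1) B;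
  have [e3|n3] := eqVneq (- y 0 0 - y 0 1) C.
- by move: ABC; rewrite -e3 e1 e2; lra.
- by apply: (@leq_add _ _ 1 2) => //; rewrite weight_vertex// (eq_xy e1 e2) mem_head.
- apply: (@leq_add _ _ 1 2) => //; rewrite weight_vertex// (@eq_xy y A (- A - C))//
    ?in_cons ?eqxx ?orbT//; lra.
- by apply: (@leq_add _ _ 2 1) => //; rewrite weight_edge//; exists (p1, p2); rewrite
    ?mem_head//; apply: triangle_edge12.
- apply: (@leq_add _ _ 1 2) => //; rewrite weight_vertex// (@eq_xy y (- B - C) B)//
    ?in_cons ?eqxx ?orbT//; lra.
- apply: (@leq_add _ _ 2 1) => //; rewrite weight_edge//; exists (p3, p1); last exact:
    triangle_edge31.
  by rewrite /= !in_cons eqxx !orbT.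
- apply: (@leq_add _ _ 2 1) => //; rewrite weight_edge//; exists (p2, p3); last exact:
    triangle_edge23.
  by rewrite /= !in_cons eqxx !orbT.
- by rewrite addn0 weight_leq3.
Qed.

Lemma loop_inv_triangle p : clockwise p -> [set` p] = vertices T ->
  loop_inv ys (view p 0) fset0 /\
  (potential ys (view p 0) fset0 + 3 <= 3 * size ys)%N.
Proof.
have abc := ABC.
rewrite vertices_triangle => cp /seteqP[pt tp].
have pT : p =i triangle by move=> y; apply/idP/idP; [apply: pt|apply: tp].
have ut : uniq triangle by exact: cw_uniq cw_triangle.
have [||inv ->] := loop_inv_start cp pT cw_triangle ut isT (ys := ys);
  last by split => //; apply: potential_triangle.
  move=> y /ysT[h1 h2 h3] e; rewrite !inE => /or3P[]/eqP->;
    by rewrite areaE !xy0 !xy1; nra.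
move=> e; rewrite !inE => /or3P[]/eqP->/=.
- by have [y yys h] := tight1; exists y => //; apply: triangle_edge12 => //; apply: ysT.
- by have [y yys h] := tight3; exists y => //; apply: triangle_edge23 => //; apply: ysT.
- by have [y yys h] := tight2; exists y => //; apply: triangle_edge31 => //; apply: ysT.
Qed.

End Triangle.

Section Rectangle.
Variables l u : R.
Hypothesis lu : l < u.
Let T := rectangle l u.
Let p1 := xy 0 l.
Let p2 := xy 0 u.
Let p3 := xy 1 u.
Let p4 := xy 1 l.
Definition corners := [:: p1; p2; p3; p4].

Lemma cw_corners : cw corners.
Proof.
have h := lu; rewrite /= !andbT !areaE !xy0 !xy1.
by rewrite -!andbA; repeat (apply/andP; split); lra.
Qed.

Lemma vertices_rectangle : vertices T = [set` corners].
Proof.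
have lu' := lu.
apply/seteqP; split => v.
  suff sub : T `<=` conv_hull corners.
    suff -> : T = conv_hull corners by exact: vertices_conv_hull_sub.
    apply/seteqP; split => //; apply: conv_hull_min => [x z t|x].
      move=> [/andP[x1 x2] /andP[x3 x4]] [/andP[z1 z2] /andP[z3 z4]] /andP[t0 t1].
      by rewrite /T /rectangle /= !mxE; split; apply/andP; split; nra.
    by rewrite !inE => /or4P[]/eqP->; rewrite /T /rectangle /= !xy0 !xy1 lexx ?ler01 lexx
        ltW.
  move=> y [/andP[y1 y2] /andP[y3 y4]].
  have n0 : u - l != 0 by rewrite subr_eq0 gt_eqF.
  have pos : 0 < u - l by rewrite subr_gt0.
  pose t := (y 0 1 - l) / (u - l).
  have t01 : 0 <= t <= 1.
    rewrite /t divr_ge0 ?subr_ge0 ?(ltW lu')//= ler_pdivrMr// mul1r; lra.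
  have -> : y = y 0 0 *: (t *: p3 + (1 - t) *: p4) +
      (1 - y 0 0) *: (t *: p2 + (1 - t) *: p1).
    by apply/pt_eqP; rewrite !mxE !eqxx /= /t; split; field.
  by apply: conv_hull_convex; rewrite ?y1 ?y2//; apply: conv_hull_convex => //;
    apply: mem_conv_hull; rewrite !in_cons eqxx ?orbT.
rewrite /= !inE => /or4P[]/eqP->; (split=> [|x y t [/andP[x1 x2] /andP[x3 x4]] [/andP[y1
    y2] /andP[y3 y4]] t01]).
all: try by rewrite /T /rectangle /= !xy0 !xy1 lexx ?ler01 lexx ltW.
all: move=> /pt_eqP; rewrite !mxE !eqxx /= => -[/esym e0 /esym e1].
all: have low (s s' r : R) : t * s + (1 - t) * s' = r -> r <= s -> r <= s' -> s = r /\ s'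
    = r
  by move=> e h h'; case/andP: (t01) => t0 t1; split; nra.
- by have [? ?] := low _ _ _ e0 x1 y1; have [? ?] := low _ _ _ e1 x3 y3; split; apply:
    eq_xy.
- by have [? ?] := low _ _ _ e0 x1 y1; have [? ?] := convex_max t01 e1 x4 y4; split;
    apply: eq_xy.
- by have [? ?] := convex_max t01 e0 x2 y2; have [? ?] := convex_max t01 e1 x4 y4; split;
    apply: eq_xy.
- by have [? ?] := convex_max t01 e0 x2 y2; have [? ?] := low _ _ _ e1 x3 y3; split;
    apply: eq_xy.
Qed.

Lemma rectangle_edge12 y : T y -> y 0 0 = 0 -> segment p1 p2 y.
Proof.
have lu' := lu; have n0 : u - l != 0 by rewrite subr_eq0 gt_eqF.
move=> [/andP[y1 y2] /andP[y3 y4]] e; exists ((y 0 1 - l) / (u - l)).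
  rewrite divr_ge0 ?subr_ge0 ?(ltW lu')//= ler_pdivrMr ?subr_gt0// mul1r; lra.
by apply/pt_eqP; rewrite !mxE !eqxx /=; split; rewrite ?e; field.
Qed.

Lemma rectangle_edge23 y : T y -> y 0 1 = u -> segment p2 p3 y.
Proof.
move=> [y12 /andP[y3 y4]] e; exists (y 0 0) => //.
by apply/pt_eqP; rewrite !mxE !eqxx /=; split; rewrite ?e; ring.
Qed.

Lemma rectangle_edge34 y : T y -> y 0 0 = 1 -> segment p3 p4 y.
Proof.
have lu' := lu; have n0 : u - l != 0 by rewrite subr_eq0 gt_eqF.
move=> [/andP[y1 y2] /andP[y3 y4]] e; exists ((u - y 0 1) / (u - l)).
  rewrite divr_ge0 ?subr_ge0 ?(ltW lu')//= ler_pdivrMr ?subr_gt0// mul1r; lra.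
by apply/pt_eqP; rewrite !mxE !eqxx /=; split; rewrite ?e; field.
Qed.

Lemma rectangle_edge41 y : T y -> y 0 1 = l -> segment p4 p1 y.
Proof.
move=> [/andP[y1 y2] /andP[y3 y4]] e; exists (1 - y 0 0); first by apply/andP; split; lra.
by apply/pt_eqP; rewrite !mxE !eqxx /=; split; rewrite ?e; ring.
Qed.

Variable ys : seq pt.
Hypothesis ysT : forall y, y \in ys -> T y.
Hypothesis tight1 : exists2 y, y \in ys & y 0 0 = 0.
Hypothesis tight2 : exists2 y, y \in ys & y 0 1 = u.
Hypothesis tight3 : exists2 y, y \in ys & y 0 0 = 1.
Hypothesis tight4 : exists2 y, y \in ys & y 0 1 = l.

Lemma potential_rectangle : (potential ys corners fset0 + 4 <= 3 * size ys)%N.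
Proof.
have lu' := lu; pose E : seq (pred pt) := [:: (fun y => y 0 0 == 0); (fun y => y 0 1 == u) ;
  (fun y => y 0 0 == 1); (fun y => y 0 1 == l)].
apply: (@potential_tight _ ys corners E); last first.
  rewrite /E /= andbT; apply/and4P; split; apply/hasP.
  - by have [y yys /eqP] := tight1; exists y.
  - by have [y yys /eqP] := tight2; exists y.
  - by have [y yys /eqP] := tight3; exists y.
  - by have [y yys /eqP] := tight4; exists y.
have vertex y s t : y 0 0 = s -> y 0 1 = t -> xy s t \in corners ->
    (weight corners fset0 y <= 1)%N.
  by move=> e0 e1; rewrite -(eq_xy e0 e1); apply: weight_vertex.
have edge y e : segment e.1 e.2 y -> e \in edges corners -> (weight corners fset0 y <= 2)%N.
  by move=> sy ee; apply: weight_edge; exists e.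
have ne01 : (0 == 1 :> R) = false by rewrite eq_sym oner_eq0.
have nelu : (l == u) = false by rewrite lt_eqF.
have neul : (u == l) = false by rewrite gt_eqF.
move=> y yys; have Ty := ysT yys; rewrite /E /= addn0.
have [e0|n0] := eqVneq (y 0 0) 0.
  rewrite e0 ne01 add0n.
  have [e1|n1] := eqVneq (y 0 1) u.
    rewrite e1 neul; apply: (@leq_add _ _ 1 2) => //.
    by apply: vertex e0 e1 _; rewrite !in_cons eqxx ?orbT.
  have [e1|n2] := eqVneq (y 0 1) l.
    apply: (@leq_add _ _ 1 2) => //.
    by apply: vertex e0 e1 _; rewrite !in_cons eqxx ?orbT.
  apply: (@leq_add _ _ 2 1) => //; apply: (edge y (p1, p2)).
    exact: rectangle_edge12.
  by rewrite /= !in_cons eqxx ?orbT.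
have [e0|n0'] := eqVneq (y 0 0) 1.
  have [e1|n1] := eqVneq (y 0 1) u.
    rewrite e1 neul; apply: (@leq_add _ _ 1 2) => //.
    by apply: vertex e0 e1 _; rewrite !in_cons eqxx ?orbT.
  have [e1|n2] := eqVneq (y 0 1) l.
    apply: (@leq_add _ _ 1 2) => //.
    by apply: vertex e0 e1 _; rewrite !in_cons eqxx ?orbT.
  apply: (@leq_add _ _ 2 1) => //; apply: (edge y (p3, p4)).
    exact: rectangle_edge34.
  by rewrite /= !in_cons eqxx ?orbT.
have [e1|n1] := eqVneq (y 0 1) u.
  rewrite e1 neul; apply: (@leq_add _ _ 2 1) => //; apply: (edge y (p2, p3)).
    exact: rectangle_edge23.
  by rewrite /= !in_cons eqxx ?orbT.
have [e1|n2] := eqVneq (y 0 1) l.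
  apply: (@leq_add _ _ 2 1) => //; apply: (edge y (p4, p1)).
    exact: rectangle_edge41.
  by rewrite /= !in_cons eqxx ?orbT.
by rewrite addn0 weight_leq3.
Qed.

Lemma loop_inv_rectangle p : clockwise p -> [set` p] = vertices T ->
  loop_inv ys (view p 0) fset0 /\
  (potential ys (view p 0) fset0 + 4 <= 3 * size ys)%N.
Proof.
have lu' := lu; rewrite vertices_rectangle => cp /seteqP[pt tp].
have pT : p =i corners by move=> y; apply/idP/idP; [apply: pt|apply: tp].
have ut : uniq corners by exact: cw_uniq cw_corners.
have [||inv ->] := loop_inv_start cp pT cw_corners ut isT (ys := ys);
  last by split => //; apply: potential_rectangle.
  move=> y /ysT[/andP[y1 y2] /andP[y3 y4]] e; rewrite !inE => /or4P[]/eqP->;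
    by rewrite areaE !xy0 !xy1; nra.
move=> e; rewrite !inE => /or4P[]/eqP->/=.
- by have [y yys h] := tight1; exists y => //; apply: rectangle_edge12 => //; apply: ysT.
- by have [y yys h] := tight2; exists y => //; apply: rectangle_edge23 => //; apply: ysT.
- by have [y yys h] := tight3; exists y => //; apply: rectangle_edge34 => //; apply: ysT.
- by have [y yys h] := tight4; exists y => //; apply: rectangle_edge41 => //; apply: ysT.
Qed.

End Rectangle.

End InitialPolygons.

(** * The planar algorithm *)

Section PlanarAlgorithm.
Variables (R : realType) (ys : seq 'rV[R]_2) (ask : 'rV[R]_2 -> R -> Prop).
Notation pt := 'rV[R]_2.
Hypothesis ys_reduced : reduced ys.
Hypothesis ys_small : (size ys <= 3)%N.
Hypothesis ask_exists : forall d, exists r, ask d r.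
Hypothesis ask_support : forall d r, ask d r -> support_value ys d r.
Notation step := (planar_step ask 3).

(** The potential is at most [3 m - 4], and with the possible additional call for
[m = 2] this is at most [2 m - 1]. *)
Lemma planar_rectangle l u p : l < u -> clockwise p ->
  [set` p] = vertices (rectangle l u) ->
  (forall y, y \in ys -> rectangle l u y) ->
  (exists2 y, y \in ys & y 0 0 = 0) -> (exists2 y, y \in ys & y 0 1 = u) ->
  (exists2 y, y \in ys & y 0 0 = 1) -> (exists2 y, y \in ys & y 0 1 = l) ->
  terminates_within step (planar_result ys) (PLoop p fset0 0) (2 * size ys - 1).
Proof.
move=> lu cp pv ysT t1 t2 t3 t4.
have [inv pot] := loop_inv_rectangle lu ysT t1 t2 t3 t4 cp pv.
apply: planar_loop => //; case: (ltnP (size ys) 3) => h; lia.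
Qed.

Hypothesis ys0 : ys != [::].

Lemma outer_polygonE (r : pt -> R) : outer_polygon (init_directions R) r =
  [set y | [/\ y 0 0 <= r (plane_e1 R), y 0 1 <= r (plane_e2 R)
             & - y 0 0 - y 0 1 <= r (- plane_e1 R - plane_e2 R)]].
Proof.
have e1E y : dotp y (plane_e1 R) = y 0 0.
  by rewrite dotp2E !mxE /=; ring.
have e2E y : dotp y (plane_e2 R) = y 0 1.
  by rewrite dotp2E !mxE /=; ring.
apply/seteqP; split => y.
  move=> H; have h d := H d; split.
  - by rewrite -e1E; apply: h; rewrite mem_head.
  - by rewrite -e2E; apply: h; rewrite !in_cons eqxx orbT.
  - by rewrite -e1E -e2E -!dotpNr -dotpDr; apply: h; rewrite !in_cons eqxx !orbT.
move=> [h1 h2 h3] d; rewrite !inE => /or3P[]/eqP->.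
- by rewrite e1E.
- by rewrite e2E.
- by rewrite dotpDr !dotpNr e1E e2E.
Qed.

Lemma size_ys_gt0 : (0 < size ys)%N.
Proof. by case: ys ys0. Qed.

Section Answers.
Variable r : pt -> R.
Hypothesis ask_r : {in init_directions R, forall d, ask d (r d)}.
Let A := r (plane_e1 R).
Let B := r (plane_e2 R).
Let C := r (- plane_e1 R - plane_e2 R).
Let T : set pt := [set y | [/\ y 0 0 <= A, y 0 1 <= B & - y 0 0 - y 0 1 <= C]].

Let e1E (y : pt) : dotp (plane_e1 R) y = y 0 0.
Proof. by rewrite dotp2E !mxE /=; ring. Qed.
Let e2E (y : pt) : dotp (plane_e2 R) y = y 0 1.
Proof. by rewrite dotp2E !mxE /=; ring. Qed.

Let s1 : support_value ys (plane_e1 R) A.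
Proof. by apply/ask_support/ask_r; rewrite mem_head. Qed.
Let s2 : support_value ys (plane_e2 R) B.
Proof. by apply/ask_support/ask_r; rewrite !in_cons eqxx orbT. Qed.
Let s3 : support_value ys (- plane_e1 R - plane_e2 R) C.
Proof. by apply/ask_support/ask_r; rewrite !in_cons eqxx !orbT. Qed.

Lemma answers_tight : [/\ exists2 y, y \in ys & y 0 0 = A,
  exists2 y, y \in ys & y 0 1 = B & exists2 y, y \in ys & - y 0 0 - y 0 1 = C].
Proof.
split.
- by have [[y yys e] _] := s1; exists y; rewrite -?e1E.
- by have [[y yys e] _] := s2; exists y; rewrite -?e2E.
- by have [[y yys e] _] := s3; exists y; rewrite // -e1E -e2E -!dotpNl -dotpDl.
Qed.

Lemma answers_in y : y \in ys -> T y.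
Proof.
have [[_ h1] [_ h2] [_ h3]] := And3 s1 s2 s3; move=> yys; split.
- by rewrite -e1E; apply: h1.
- by rewrite -e2E; apply: h2.
- by rewrite -e1E -e2E -!dotpNl -dotpDl; apply: h3.
Qed.

Lemma answers_point : ~ 0 < A + B + C -> exists2 y, T = [set y] & ys = [:: y].
Proof.
move=> /negP; rewrite -leNgt => ABC.
have Ty z : T z -> z = xy A B by move=> [z1 z2 z3]; apply: eq_xy; lra.
have ysE z : z \in ys -> z = xy A B by move=> /answers_in/Ty.
have ys1 : ys = [:: xy A B].
  case: ys ys0 ysE (ys_reduced.1) => // y [|z s] _ ysE.
    by rewrite (ysE y) ?mem_head.
  by rewrite (ysE y) ?mem_head// (ysE z) ?in_cons ?eqxx ?orbT//= inE eqxx.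
exists (xy A B) => //; apply/seteqP; split => [z /Ty//|_ ->].
by apply: answers_in; rewrite ys1 mem_head.
Qed.

Lemma answers_polygon : 0 < A + B + C ->
  ~ (exists y, T = [set y]) /\ (1 < size ys)%N.
Proof.
move=> ABC; split.
  move=> [y Ty].
  have h1 : T (xy A B) by rewrite /T /= xy0 xy1; split; lra.
  have h2 : T (xy A (- A - C)) by rewrite /T /= xy0 xy1; split; lra.
  move: h1 h2; rewrite Ty /= => <- /pt_eqP[_]; rewrite !xy1; lra.
rewrite ltn_neqAle size_ys_gt0 andbT eq_sym; apply/eqP => sz.
have [[y1 h1 e1] [y2 h2 e2] [y3 h3 e3]] := answers_tight.
case: ys sz h1 h2 h3 => // y [|//] _; rewrite !inE => /eqP h1 /eqP h2 /eqP h3.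
by move: ABC; rewrite -e1 -e2 -e3 h1 h2 h3; lra.
Qed.

End Answers.

(** The potential is at most [3 m - 3], and with the possible additional call for
[m = 2] this is at most [2 m]. *)
Lemma planar_triangle : terminates_within step (planar_result ys) PInit
  (if size ys == 1 then 3 else 3 + 2 * size ys).
Proof.
apply: terminates_within_intro.
  have [r ask_r] := choice ask_exists.
  have ask_r' : {in init_directions R, forall d, ask d (r d)} by move=> d _.
  have [ABC|ABC] := pselect (0 < r (plane_e1 R) + r (plane_e2 R) + r (- plane_e1 R -
      plane_e2 R)).
    have [np _] := answers_polygon ask_r' ABC.
    exists 3%N, (PLoop (triangle (r (plane_e1 R)) (r (plane_e2 R)) (r (- plane_e1 R -
        plane_e2 R))) fset0 0).
    apply: (PStartPolygon _ ask_r').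
    - by rewrite outer_polygonE.
    - by apply/clockwiseP; have := cw_triangle ABC; split => //; apply: cw_uniq.
    - by rewrite outer_polygonE vertices_triangle.
  have [y Ty _] := answers_point ask_r' ABC.
  by exists 3%N, (PDone [fset y]%fset); apply: (PStartPoint _ ask_r'); rewrite
      outer_polygonE.
move=> m c' st; inversion st as [r y ask_r Ty|r p ask_r np cp pv| | | |]; subst.
  exists 0%N; first by case: ifP.
  rewrite outer_polygonE in Ty.
  have [ABC|ABC] := pselect (0 < r (plane_e1 R) + r (plane_e2 R) + r (- plane_e1 R -
      plane_e2 R)).
    by have [[]] := answers_polygon ask_r ABC; exists y.
  have [z Tz ysz] := answers_point ask_r ABC.
  have yz : y = z by have e : [set y] = [set z] := etrans (esym Ty) Tz;
    have : [set z] y by rewrite -e.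
  apply: within_final; first exact: halted_done.
  by exists [fset y]%fset => // x; rewrite ysz yz !inE.
rewrite outer_polygonE in np; rewrite outer_polygonE in pv.
have [ABC|ABC] := pselect (0 < r (plane_e1 R) + r (plane_e2 R) + r (- plane_e1 R -
    plane_e2 R)); last first.
  by have [z Tz _] := answers_point ask_r ABC; case: np; exists z.
have [_ sz] := answers_polygon ask_r ABC.
have [t1 t2 t3] := answers_tight ask_r.
have [inv pot] := loop_inv_triangle ABC (answers_in ask_r) t1 t2 t3 cp pv.
exists (2 * size ys)%N; first by rewrite gtn_eqF.
apply: planar_loop => //; case: (ltnP (size ys) 3) => h; lia.
Qed.

End PlanarAlgorithm.

Lemma rectangle_enumeration (R : realType) (l u : R) : l < u ->
  exists2 p, clockwise p & [set` p] = vertices (rectangle l u).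
Proof.
move=> lu; exists (corners l u); last by rewrite vertices_rectangle.
by apply/clockwiseP; have := cw_corners lu; split => //; apply: cw_uniq.
Qed.

(** * Projections onto the first coordinates *)

Section Coordinates.
Variables (R : realType) (n : nat).
Implicit Types (x y v d : 'rV[R]_n) (k : nat).

Definition proj_first k x : 'rV[R]_n := \row_j (if (j < k)%N then x 0 j else 0).

Lemma proj_first_affine k : affine (proj_first k).
Proof. by move=> x y t; apply/rowP => j; rewrite !mxE; case: ifP; rewrite ?mulr0 ?addr0.
    Qed.

Lemma proj_first_in_first k x : in_first k (proj_first k x).
Proof. by move=> j kj; rewrite mxE ltnNge kj. Qed.

Lemma proj_first_id k x : in_first k x -> proj_first k x = x.
Proof. by move=> xk; apply/rowP => j; rewrite mxE; case: ltnP => // /xk. Qed.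

Lemma proj_first_n x : proj_first n x = x.
Proof. by apply: proj_first_id => j; rewrite leqNgt ltn_ord. Qed.

Lemma dotp_proj k d x : in_first k d -> dotp d (proj_first k x) = dotp d x.
Proof.
move=> dk; rewrite !dotpE; apply: eq_bigr => j _; rewrite mxE.
by case: ltnP => // /dk ->; rewrite !mul0r.
Qed.

Lemma in_firstD k x y : in_first k x -> in_first k y -> in_first k (x + y).
Proof. by move=> hx hy j kj; rewrite mxE hx// hy// addr0. Qed.

Lemma in_firstZ k a x : in_first k x -> in_first k (a *: x).
Proof. by move=> hx j kj; rewrite mxE hx// mulr0. Qed.

Lemma in_firstN k x : in_first k x -> in_first k (- x).
Proof. by move=> hx j kj; rewrite mxE hx// oppr0. Qed.

Lemma in_first_leq k k' x : (k <= k')%N -> in_first k x -> in_first k' x.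
Proof. by move=> kk' hx j kj; apply: hx; apply: leq_trans kj. Qed.

Lemma in_first_unit k : in_first k (unit_vec R n k).
Proof. by move=> j kj; rewrite mxE gtn_eqF. Qed.

Lemma dotp_unit k x (j : 'I_n) : j.+1 = k -> dotp x (unit_vec R n k) = x 0 j.
Proof.
move=> jk; rewrite dotpE (bigD1 j)//= mxE jk eqxx mulr1 big1 ?addr0// => i ij.
rewrite mxE -jk eqSS (_ : (_ == _ :> nat) = false) ?mulr0//.
by apply: contraNF ij => /eqP/val_inj->.
Qed.

Lemma dotp_unit_unit k : (0 < k <= n)%N -> dotp (unit_vec R n k) (unit_vec R n k) = 1.
Proof.
case: k => // k kn; rewrite (@dotp_unit _ _ (Ordinal kn))//.
by rewrite mxE eqxx.
Qed.

Lemma dotp_unit0 k x : in_first k.-1 x -> dotp x (unit_vec R n k) = 0.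
Proof.
move=> hx; rewrite dotpE big1// => j _; rewrite mxE.
by case: eqP => [<-|_] in hx *; rewrite ?mulr0// hx// mul0r.
Qed.

Lemma proj_first_step k v : (0 < k)%N ->
  proj_first k v = proj_first k.-1 v + dotp v (unit_vec R n k) *: unit_vec R n k.
Proof.
case: k => // k _; apply/rowP => j; rewrite !mxE eqSS ltnS leq_eqVlt.
case: eqP => [jk|_]; last by rewrite mulr0 addr0.
by rewrite (@dotp_unit _ _ j) ?jk// ltnn mulr1 add0r.
Qed.

Lemma set_coordE k h x : in_first k.-1 x ->
  set_coord k h x = x + h *: unit_vec R n k.
Proof.
move=> hx; apply/rowP => j; rewrite !mxE; case: eqP => [jk|_].
  by rewrite hx -?jk// mulr1 add0r.
by rewrite mulr0 addr0.
Qed.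

Lemma proj_first_add_unit k h x : (0 < k)%N -> in_first k.-1 x ->
  proj_first k.-1 (x + h *: unit_vec R n k) = x.
Proof.
case: k => // k _ hx; apply/rowP => j; rewrite !mxE /= eqSS; case: ltnP => [jk|/hx->//].
by rewrite ltn_eqF// mulr0 addr0.
Qed.

End Coordinates.

(** * Vertices of successive projections *)

Section Lifting.
Variables (R : realType) (n : nat) (vs : seq 'rV[R]_n) (D : 'rV[R]_n -> R).
Hypothesis vs0 : vs != [::].
Hypothesis vs_small : (size vs <= 3)%N.
Hypothesis D_support : forall d, support_value vs d (D d).
Implicit Types (x y v d : 'rV[R]_n) (xs : seq 'rV[R]_n) (k : nat).
Notation unit := (unit_vec R n).
Notation step := (three_vertex_step D).

Definition projected_vertices k xs :=
  reduced xs /\ conv_hull xs = conv_hull (map (proj_first k) vs).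

Lemma projected_sub k xs : projected_vertices k xs -> {subset xs <= map (proj_first k) vs}.
Proof. by move=> [rx cx]; apply: reduced_sub. Qed.

Lemma projected_in_first k xs x : projected_vertices k xs -> x \in xs -> in_first k x.
Proof. by move=> /projected_sub sub /sub /mapP[v _ ->]; apply: proj_first_in_first. Qed.

Lemma projected_size k xs : projected_vertices k xs -> (0 < size xs <= size vs)%N.
Proof.
move=> /[dup] pv [[uxs _] cx]; apply/andP; split.
  case: xs cx {pv uxs} => // cx; case: vs vs0 cx => // v s _ cx.
  have : conv_hull [::] (proj_first k v) by rewrite cx; apply/mem_conv_hull; rewrite
      mem_head.
  by case=> w []; rewrite big_ord0 => _ /eqP; rewrite eq_sym oner_eq0.
by rewrite -(size_map (proj_first k) vs); apply: uniq_leq_size => //; apply: projected_sub.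
Qed.

Lemma eq_projected k xs xs' : projected_vertices k xs -> uniq xs' -> xs' =i xs ->
  projected_vertices k xs'.
Proof.
move=> [rx cx] ux e; split; last by rewrite -cx; apply: eq_conv_hull.
by apply: eq_reduced rx => // y; rewrite e.
Qed.

(** Lifting the vertices of a projection one coordinate up keeps them in convex
    position, whatever heights are chosen. *)
Lemma projected_lift k xs xs' : projected_vertices k.-1 xs ->
  map (proj_first k.-1) xs' = xs -> xs' =i map (proj_first k) vs -> projected_vertices k
      xs'.
Proof.
move=> [rx _] e mx; split; last exact: eq_conv_hull.
by apply: (reduced_of_map (@proj_first_affine R n k.-1)); rewrite e.
Qed.

Lemma height_range k v : v \in vs -> lower D k <= dotp v (unit k) <= upper D k.
Proof.
move=> vvs; rewrite /lower /upper dotpC.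
have [_ h1] := D_support (unit k); have [_ h2] := D_support (- unit k).
by rewrite h1// andbT lerNl -dotpNl h2.
Qed.

Lemma height_attained k : (exists2 v, v \in vs & dotp v (unit k) = lower D k) /\
  (exists2 v, v \in vs & dotp v (unit k) = upper D k).
Proof.
rewrite /lower /upper.
have [[v vvs vE] _] := D_support (unit k); have [[w wvs wE] _] := D_support (- unit k).
split; [exists w|exists v] => //; last by rewrite dotpC.
by rewrite -wE dotpNl opprK dotpC.
Qed.

Lemma lower_upper k : lower D k <= upper D k.
Proof.
have [[v vvs _] _] := height_attained k.
by have /andP[h1 h2] := height_range k vvs; apply: le_trans h2.
Qed.

Lemma step_flat k xs : (0 < k)%N -> projected_vertices k.-1 xs ->
  lower D k = upper D k ->
  projected_vertices k [seq set_coord k (lower D k) x | x <- xs].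
Proof.
move=> k0 pv lu; have [rx cx] := pv.
have coordE x : x \in xs -> set_coord k (lower D k) x = x + lower D k *: unit k.
  by move=> xxs; rewrite set_coordE//; apply: projected_in_first pv xxs.
have mE : [seq set_coord k (lower D k) x | x <- xs] =
  [seq x + lower D k *: unit k | x <- xs] by apply/eq_in_map.
have aff : affine (fun x => x + lower D k *: unit k).
  move=> x y t; rewrite !scalerDr addrACA -scalerDl; congr (_ + _).
  by rewrite addrC subrK scale1r.
rewrite mE; split.
  apply: (reduced_of_map (@proj_first_affine R n k.-1)); rewrite -map_comp.
  rewrite (_ : map _ _ = xs)//; apply: map_id_in => x xxs /=.
  by rewrite proj_first_add_unit//; apply: projected_in_first pv xxs.
rewrite (conv_hull_map aff) cx -(conv_hull_map aff) -map_comp; congr conv_hull.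
apply/eq_in_map => v vvs; rewrite /= [proj_first k v]proj_first_step//.
by have := height_range k vvs; rewrite -lu => /andP[h1 h2]; congr (_ + _ *: _);
  apply/eqP; rewrite eq_le h1 h2.
Qed.

Lemma step_point k x1 : (0 < k <= n)%N -> projected_vertices k.-1 [:: x1] ->
  lower D k < upper D k ->
  projected_vertices k [:: set_coord k (lower D k) x1; set_coord k (upper D k) x1].
Proof.
move=> /[dup] kn /andP[k0 _] pv lu; have [_ cx] := pv.
have x1k : in_first k.-1 x1 by apply: (projected_in_first pv); rewrite mem_head.
have projE v : v \in vs -> proj_first k v = x1 + dotp v (unit k) *: unit k.
  move=> vvs; rewrite proj_first_step//; congr (_ + _).
  suff : conv_hull [:: x1] (proj_first k.-1 v) by rewrite conv_hull1.
  by rewrite cx; apply/mem_conv_hull/map_f.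
rewrite !set_coordE//; split.
  apply: reduced2; rewrite (inj_eq (addrI _)).
  apply/negP => /eqP e.
  have := congr1 (fun z => dotp z (unit k)) e.
  by rewrite /= !dotpZl dotp_unit_unit// !mulr1 => e'; rewrite e' ltxx in lu.
have [[v vvs vE] [w wvs wE]] := height_attained k.
apply/seteqP; split; apply: sub_conv_hull => y.
  rewrite !inE => /orP[]/eqP->; apply: mem_conv_hull; apply/mapP.
    by exists v; rewrite ?projE ?vE.
  by exists w; rewrite ?projE ?wE.
move=> /mapP[z zvs ->]; rewrite projE//.
have /andP[h1 h2] := height_range k zvs.
set l := lower D k in lu h1 *; set u := upper D k in lu h2 *; set h := dotp z _ in h1 h2 *.
have ul : u - l != 0 by rewrite subr_eq0 gt_eqF.
have -> : x1 + h *: unit k = ((u - h) / (u - l)) *: (x1 + l *: unit k) +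
   (1 - (u - h) / (u - l)) *: (x1 + u *: unit k).
  by apply/rowP => j; rewrite !mxE; field.
apply: conv_hull_convex; rewrite ?divr_ge0 ?subr_ge0 ?(ltW lu)//=; last 1 first.
  rewrite ler_pdivrMr ?subr_gt0// mul1r; lra.
all: by apply: mem_conv_hull; rewrite !inE eqxx ?orbT.
Qed.

(** In Case III each vertex of the previous projection lies below exactly one
    vertex of the polytope; the query reads off its height. *)
Lemma step_three k xs (d : nat -> 'rV[R]_n) (beta : nat -> R) :
  (0 < k)%N -> projected_vertices k.-1 xs -> lower D k < upper D k -> size xs = 3 ->
  (forall j, (j < 3)%N ->
       caseIII_direction k (lower D k) (upper D k) xs j (d j) (beta j)) ->
  projected_vertices k (mkseq (fun j => set_coord k
            (lower D k + (D (d j) - beta j) * (upper D k - lower D k))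
            xs`_j) 3).
Proof.
move=> k0 pv lu sx dir; have [[uxs _] _] := pv.
have sv : size vs = 3 by have /andP[_] := projected_size pv; rewrite sx => h; apply/eqP;
    rewrite eqn_leq vs_small.
have mx : map (proj_first k.-1) vs =i xs.
  have [|_ h] := uniq_min_size uxs (projected_sub pv); first by rewrite size_map sv sx.
  by move=> y; rewrite h.
have up : uniq (map (proj_first k.-1) vs).
  by rewrite (eq_uniq _ mx)// size_map sv sx.
have pinj : {in vs &, injective (proj_first k.-1)}.
  move=> v w vvs wvs e; apply/eqP; rewrite -(nth_index v vvs) -(nth_index v wvs).
  rewrite nth_uniq ?index_mem//; last exact: map_uniq up.
  rewrite -(nth_uniq (proj_first k.-1 v) _ _ up) ?size_map ?index_mem//.
  by rewrite !(nth_map v) ?index_mem// !nth_index// e.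
have [v vE] : exists v : nat -> 'rV[R]_n, forall j, (j < 3)%N ->
    v j \in vs /\ proj_first k.-1 (v j) = xs`_j.
  have h j : exists v, (j < 3)%N -> v \in vs /\ proj_first k.-1 v = xs`_j.
    have [j3|j3] := ltnP j 3; last by exists 0.
    have : xs`_j \in map (proj_first k.-1) vs by rewrite mx mem_nth// sx.
    by move=> /mapP[v vvs ->]; exists v.
  by have [v hv] := choice h; exists v.
have coordE j : (j < 3)%N -> set_coord k
    (lower D k + (D (d j) - beta j) * (upper D k - lower D k)) xs`_j = proj_first k (v j).
  move=> j3; have [vj vjE] := vE j j3; have [dk d0 d1] := dir j j3.
  have lin x h : dotp (d j) (x + h *: unit k) = dotp (d j) x + h * dotp (d j) (unit k).
    by rewrite dotpDr dotpZr.
  set dk1 := dotp (d j) (unit k) in lin.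
  have dkE : dk1 * (upper D k - lower D k) = 1.
    by have := d1 j j3; rewrite eqxx mulr1n; move: d0; rewrite !lin; lra.
  have dkp : 0 < dk1 by move: dkE lu => + lu; rewrite -subr_gt0 in lu; nra.
  have dE w : dotp (d j) w = dotp (d j) (proj_first k.-1 w) + dotp w (unit k) * dk1.
    by rewrite -(dotp_proj w dk) proj_first_step// lin.
  (* At a vertex of [X] above another point the query is at most [beta j]; above
     [xs`_j] it is at least [beta j]. *)
  have DE : D (d j) = beta j + (dotp (v j) (unit k) - lower D k) * dk1.
    have [[w wvs wE] le] := D_support (d j).
    have hv : dotp (d j) (v j) = beta j + (dotp (v j) (unit k) - lower D k) * dk1.
      by rewrite dE vjE; move: d0; rewrite lin; lra.
    apply/eqP; rewrite eq_le -{2}hv le// andbT -wE.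
    have [->|wv] := eqVneq w (v j); first by rewrite hv.
    have : proj_first k.-1 w \in xs by rewrite -mx map_f.
    move=> /(nthP 0)[i]; rewrite sx => i3 iE.
    have ij : i != j.
      apply: contra_neq wv => ij; apply: pinj => //; by rewrite vjE -iE ij.
    have := d1 i i3; rewrite (negPf ij) mulr0n lin iE => h; rewrite dE.
    have /andP[_ wu] := height_range k wvs.
    have /andP[vl _] := height_range k vj.
    have h1 : 0 <= (upper D k - dotp w (unit k)) * dk1 by rewrite mulr_ge0 ?subr_ge0// ltW.
    have h2 : 0 <= (dotp (v j) (unit k) - lower D k) * dk1 by rewrite mulr_ge0
        ?subr_ge0// ltW.
    lra.
  rewrite DE set_coordE; last first.
    by apply: (projected_in_first pv); rewrite mem_nth// sx.
  rewrite proj_first_step// vjE; congr (_ + _ *: _).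
  by rewrite addrAC subrr add0r -mulrA dkE mulr1 addrC subrK.
set xs' := mkseq _ 3; have xs'E : xs' = [seq proj_first k (v j) | j <- iota 0 3].
  by apply/eq_in_map => j; rewrite mem_iota add0n => /andP[_ /coordE].
have comp w : proj_first k.-1 (proj_first k w) = proj_first k.-1 w.
  by apply/rowP => j; rewrite !mxE; case: ltnP => // jk; rewrite (leq_trans jk (leq_pred
      k)).
apply: (projected_lift pv).
  rewrite xs'E -map_comp; apply: (@eq_from_nth _ 0); first by rewrite size_map size_iota sx.
  move=> j; rewrite size_map size_iota => j3.
  by rewrite (nth_map 0%N) ?size_iota// nth_iota//= comp; have [_ ->] := vE j j3.
move=> y; rewrite xs'E; apply/mapP/mapP => -[j].
  by rewrite mem_iota add0n => /andP[_ /vE[vj _]] ->; exists (v j).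
move=> jvs ->; have : proj_first k.-1 j \in xs by rewrite -mx map_f.
move=> /(nthP 0)[i]; rewrite sx => i3 iE; exists i; first by rewrite mem_iota.
have [vi viE] := vE i i3; congr proj_first; apply: pinj => //; by rewrite viE.
Qed.

(** The coefficient of the new coordinate has to be [1 / (u - l)]; the remaining part
must then take at the two other vertices a value one below that at the vertex
[j]. *)
Lemma caseIII_direction_exists k xs j : (0 < k <= n)%N ->
  projected_vertices k.-1 xs -> lower D k < upper D k -> size xs = 3 -> (j < 3)%N ->
  exists d beta, caseIII_direction k (lower D k) (upper D k) xs j d beta.
Proof.
move=> kn pv lu sx j3; have [rx _] := pv; have [uxs _] := rx.
have mem i : (i < 3)%N -> xs`_i \in xs by move=> i3; rewrite mem_nth// sx.
have ne i i' : (i < 3)%N -> (i' < 3)%N -> i != i' -> xs`_i != xs`_i'.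
  by move=> i3 i3' ii'; rewrite nth_uniq ?sx.
have [i1 [i2 [i13 i23 others]]] : exists i1 i2, [/\ (i1 < 3)%N, (i2 < 3)%N &
    [/\ j != i1, j != i2, i1 != i2 & forall i, (i < 3)%N -> i != j -> i = i1 \/ i = i2]].
  by move: j j3 => [|[|[|//]]] _; [exists 1%N, 2%N|exists 0%N, 2%N|exists 0%N, 1%N];
    (split => //; split => // -[|[|[|//]]]); auto.
have [j1 j2 i12 oth] := others.
have [a [b [d1 d2]]] := reduced3_direction rx (mem _ j3) (mem _ i13) (mem _ i23)
  (ne _ _ j3 i13 j1) (ne _ _ j3 i23 j2) (ne _ _ i13 i23 i12).
set d0 := _ + _ in d1 d2.
have xk i : (i < 3)%N -> in_first k.-1 (xs`_i) by move=> /mem; apply: projected_in_first pv.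
have dk0 : in_first k.-1 d0.
  have wk i : (i < 3)%N -> in_first k.-1 (xs`_i - xs`_j).
    by move=> i3; apply: in_firstD; [apply: xk|apply/in_firstN/xk].
  by apply: in_firstD; apply: in_firstZ; apply: wk.
set l := lower D k in lu *; set u := upper D k in lu *.
have ul : u - l != 0 by rewrite subr_eq0 gt_eqF.
pose d := (u - l)^-1 *: unit k + d0.
have dx i : (i < 3)%N -> dotp d xs`_i = dotp d0 xs`_i.
  by move=> i3; rewrite dotpDl dotpZl (dotpC (unit k)) dotp_unit0 ?mulr0 ?add0r//; apply:
      xk.
have du : dotp d (unit k) = (u - l)^-1.
  by rewrite dotpDl dotpZl dotp_unit_unit// mulr1 dotp_unit0// addr0.
exists d, (dotp d0 xs`_j + l / (u - l)); split.
- apply: in_firstD; first by apply/in_firstZ/in_first_unit.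
  by apply: in_first_leq dk0; apply: leq_pred.
- by rewrite dotpDr dotpZr du dx// subrr.
- move=> i i3; rewrite dotpDr dotpZr du dx//.
  have e : u / (u - l) - l / (u - l) = 1 by rewrite -mulrBl divff.
  have [->|ij] := eqVneq i j; first by rewrite mulr1n; lra.
  have : dotp d0 (xs`_i - xs`_j) = -1 by case: (oth i i3 ij) => ->.
  by rewrite dotpBr mulr0n => h; lra.
Qed.

End Lifting.

(** * Planar copies of the projections *)

Section PlanarPhases.
Variables (R : realType) (n : nat) (vs : seq 'rV[R]_n) (D : 'rV[R]_n -> R).
Hypothesis n_ge2 : (2 <= n)%N.
Hypothesis vs0 : vs != [::].
Hypothesis D_support : forall d, support_value vs d (D d).
Implicit Types (x v d : 'rV[R]_n) (xs : seq 'rV[R]_n) (k : nat).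
Notation unit := (unit_vec R n).
Notation step := (three_vertex_step D).
Notation pt := 'rV[R]_2.

(** Both planar phases run on a planar copy of the projection, given by a
    coordinate map [g] of the points of [vs] and an affine chart [f]. *)
Lemma planar_copy k (g : 'rV[R]_n -> pt) (f : pt -> 'rV[R]_n) :
  affine f -> injective f -> (forall v, v \in vs -> f (g v) = proj_first k v) ->
  exists ys, [/\ reduced ys, (0 < size ys <= size vs)%N, {subset ys <= map g vs},
    conv_hull ys = conv_hull (map g vs) & projected_vertices vs k (map f ys)].
Proof.
move=> fa fi fg; have [ys [ry sy cy]] := reduced_exists (map g vs).
have pv : projected_vertices vs k (map f ys).
  split; first by apply: reduced_map => // x y _ _; apply: fi.
  rewrite (conv_hull_map fa) cy -(conv_hull_map fa) -map_comp; congr conv_hull.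
  by apply/eq_in_map => v vvs; rewrite /= fg.
exists ys; split => //; by have := projected_size vs0 pv; rewrite size_map.
Qed.

Lemma planar_support k (g : 'rV[R]_n -> pt) ys (e : pt) d (x1 : 'rV[R]_n) :
  conv_hull ys = conv_hull (map g vs) ->
  (forall v, v \in vs -> dotp d v = dotp d x1 + dotp e (g v)) ->
  support_value ys e (D d - dotp d x1).
Proof.
move=> cy dE; apply: (support_hull_eq (esym cy)).
have [[v vvs vE] le] := D_support d; split.
  by exists (g v); [apply: map_f|rewrite -vE dE// addrAC subrr add0r].
by move=> _ /mapP[w wvs ->]; rewrite lerBrDl -dE// le.
Qed.

Section CaseII.
Variables (k : nat) (x1 x2 : 'rV[R]_n).
Hypothesis kn : (0 < k <= n)%N.
Hypothesis pv : projected_vertices vs k.-1 [:: x1; x2].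
Let w := x2 - x1.

Let w0 : w != 0.
Proof. by rewrite subr_eq0 eq_sym; have [[/=]] := pv; rewrite inE andbT. Qed.

Let x1k : in_first k.-1 x1.
Proof. by apply: (projected_in_first pv); rewrite mem_head. Qed.

Let wk : in_first k.-1 w.
Proof.
apply: in_firstD; last exact: in_firstN.
by apply: (projected_in_first pv); rewrite !inE eqxx orbT.
Qed.

Lemma caseII_affine : affine (caseII_point k x1 x2).
Proof. by move=> x y t; apply/rowP => j; rewrite !mxE; ring. Qed.

Lemma caseII_inj : injective (caseII_point k x1 x2).
Proof.
move=> y z; rewrite /caseII_point -!addrA => /addrI; rewrite -/w => e.
have e1 : y 0 1 = z 0 1.
  have := congr1 (fun u => dotp u (unit k)) e.
  by rewrite /= !dotpDl !dotpZl dotp_unit_unit// (dotp_unit0 wk) !mulr0 !add0r !mulr1.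
apply/pt_eqP; split => //.
move: e; rewrite e1 => /addIr /eqP; rewrite -subr_eq0 -scalerBl scaler_eq0 (negPf w0) orbF.
by rewrite subr_eq0 => /eqP.
Qed.

Lemma ask_caseII_exists e : exists r, ask_caseII D k x1 x2 e r.
Proof.
pose d := e 0 1 *: unit k + (e 0 0 / dotp w w) *: w.
exists (D d - dotp d x1); exists d; split => //.
- apply: in_firstD; apply: in_firstZ; first exact: in_first_unit.
  exact: in_first_leq (leq_pred k) wk.
- by rewrite dotpDl !dotpZl dotp_unit_unit// (dotp_unit0 wk) mulr0 addr0 mulr1.
- rewrite -/w dotpDl !dotpZl (dotpC (unit k)) (dotp_unit0 wk) mulr0 add0r divfK//.
  by rewrite gt_eqF// dotp_gt0.
Qed.

(** The sides of the rectangle all meet the planar copy: two of them contain the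
images of the points above [x1] and [x2], the other two those of the lowest and
highest points. *)
Lemma caseII_plane : exists ys : seq pt,
  [/\ reduced ys, (0 < size ys <= size vs)%N,
    projected_vertices vs k (map (caseII_point k x1 x2) ys),
    forall e r, ask_caseII D k x1 x2 e r -> support_value ys e r &
    [/\ forall y, y \in ys -> rectangle (lower D k) (upper D k) y,
        exists2 y, y \in ys & y 0 0 = 0, exists2 y, y \in ys & y 0 1 = upper D k,
        exists2 y, y \in ys & y 0 0 = 1 & exists2 y, y \in ys & y 0 1 = lower D k]].
Proof.
have [_ cx] := pv.
have [s sE] : exists s : 'rV[R]_n -> R, forall v, v \in vs ->
    0 <= s v <= 1 /\ proj_first k.-1 v = x1 + s v *: w.
  have h v : exists s : R, v \in vs -> 0 <= s <= 1 /\ proj_first k.-1 v = x1 + s *: w.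
    have [vvs|nvs] := boolP (v \in vs); last by exists 0.
    have : conv_hull [:: x1; x2] (proj_first k.-1 v) by rewrite cx;
        apply/mem_conv_hull/map_f.
    by move=> /conv_hull2[s s01 e]; exists s.
  by have [s hs] := choice h; exists s.
pose g v := xy (s v) (dotp v (unit k)).
have k0 : (0 < k)%N by case/andP: kn.
have fg v : v \in vs -> caseII_point k x1 x2 (g v) = proj_first k v.
  by move=> /sE[_ e]; rewrite proj_first_step// e /caseII_point xy0 xy1.
have [ys [ry sy suby cy pvy]] := planar_copy caseII_affine caseII_inj fg.
exists ys; split => //.
  move=> e r [d [dk d1 d0 ->]]; apply: (planar_support k cy) => v vvs.
  rewrite -(dotp_proj v dk) -fg// /caseII_point !dotpDr !dotpZr d1 d0.
  by rewrite dotp2E addrA mulrC (mulrC (_ 0 1)).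
have tight e r : support_value (map g vs) e r -> exists2 y, y \in ys & dotp e y = r.
  by move=> /(support_hull_eq (esym cy))[].
have end_point x (r : R) : x \in [:: x1; x2] -> x = x1 + r *: w -> exists2 v, v \in vs &
    s v = r.
  move=> /(projected_sub pv)/mapP[v vvs ->] e; exists v => //; have [_] := sE v vvs.
  rewrite e => /addrI/eqP; rewrite -subr_eq0 -scalerBl scaler_eq0 (negPf w0) orbF.
  by rewrite subr_eq0 => /eqP.
have [[vl vlvs vlE] [vu vuvs vuE]] := height_attained D_support k.
split.
- move=> y /suby/mapP[v vvs ->]; have [s01 _] := sE v vvs.
  by rewrite /rectangle /= xy0 xy1; split => //; apply: (height_range D_support).
- have [|y yys yE] := tight (xy (-1) 0) 0; last first.
    by exists y => //; move: yE; rewrite dotp2E xy0 xy1; lra.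
  have [|v vvs v0] := end_point x1 0 (mem_head _ _); first by rewrite scale0r addr0.
  split; first by exists (g v); rewrite ?map_f// dotp2E !xy0 !xy1 v0; ring.
  move=> _ /mapP[z /sE[/andP[z0 z1] _] ->]; rewrite dotp2E !xy0 !xy1; lra.
- have [|y yys yE] := tight (xy 0 1) (upper D k); last first.
    by exists y => //; move: yE; rewrite dotp2E xy0 xy1; lra.
  split; first by exists (g vu); rewrite ?map_f// dotp2E !xy0 !xy1 vuE; ring.
  move=> _ /mapP[z /(height_range D_support k)/andP[z0 z1] ->]; rewrite dotp2E !xy0 !xy1;
      lra.
- have [|y yys yE] := tight (xy 1 0) 1; last first.
    by exists y => //; move: yE; rewrite dotp2E xy0 xy1; lra.
  have [||v vvs v0] := end_point x2 1; rewrite ?inE ?eqxx ?orbT//.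
    by rewrite scale1r /w addrC subrK.
  split; first by exists (g v); rewrite ?map_f// dotp2E !xy0 !xy1 v0; ring.
  move=> _ /mapP[z /sE[/andP[z0 z1] _] ->]; rewrite dotp2E !xy0 !xy1; lra.
- have [|y yys yE] := tight (xy 0 (-1)) (- lower D k); last first.
    by exists y => //; move: yE; rewrite dotp2E xy0 xy1; lra.
  split; first by exists (g vl); rewrite ?map_f// dotp2E !xy0 !xy1 vlE; ring.
  move=> _ /mapP[z /(height_range D_support k)/andP[z0 z1] ->]; rewrite dotp2E !xy0 !xy1;
      lra.
Qed.

End CaseII.

Lemma proj2_plane : exists ys : seq pt,
  [/\ reduced ys, (0 < size ys <= size vs)%N,
    projected_vertices vs 2 (map (pad2 n) ys) &
    forall e r, ask_proj2 D e r -> support_value ys e r].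
Proof.
pose g v := xy (dotp v (unit 1)) (dotp v (unit 2)).
have aff : affine (@pad2 R n) by move=> x y t; apply/rowP => j; rewrite !mxE; ring.
have n1 : (0 < 1 <= n)%N by rewrite (ltnW n_ge2).
have u12 : dotp (unit 1) (unit 2) = 0.
  by rewrite dotp_unit0//; apply: in_first_unit.
have inj : injective (@pad2 R n).
  move=> y z e; apply/pt_eqP; split.
    have := congr1 (fun u => dotp u (unit 1)) e.
    by rewrite /= !dotpDl !dotpZl (dotpC (unit 2)) u12 dotp_unit_unit// !mulr1 !mulr0
        !addr0.
  have := congr1 (fun u => dotp u (unit 2)) e.
  by rewrite /= !dotpDl !dotpZl u12 dotp_unit_unit// !mulr1 !mulr0 !add0r.
have fg v : v \in vs -> pad2 n (g v) = proj_first 2 v.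
  have p0 : proj_first 0 v = 0 by apply/rowP => j; rewrite !mxE.
  by move=> _; rewrite proj_first_step// (@proj_first_step _ _ 1)// p0 add0r /pad2 xy0 xy1.
have [ys [ry sy suby cy pvy]] := planar_copy aff inj fg.
exists ys; split => // e r ->.
have := @planar_support 2 g ys e (pad2 n e) 0 cy.
have -> : dotp (pad2 n e) 0 = 0 by rewrite -(scale0r (0 : 'rV[R]_n)) dotpZr mul0r.
rewrite subr0; apply => v vvs.
by rewrite add0r dotpDl !dotpZl dotp2E xy0 xy1 !(dotpC (unit _)).
Qed.

End PlanarPhases.

(** * The three-vertex algorithm *)

Section Program.
Variables (R : realType) (n : nat) (vs : seq 'rV[R]_n) (D : 'rV[R]_n -> R).
Hypothesis n_ge2 : (2 <= n)%N.
Hypothesis vs_reduced : reduced vs.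
Hypothesis vs0 : vs != [::].
Hypothesis vs_small : (size vs <= 3)%N.
Hypothesis D_support : forall d, support_value vs d (D d).
Notation step := (three_vertex_step D).

Definition three_vertex_result (c : conf R n) :=
  exists2 S : {fset 'rV[R]_n}, c = Return S & S =i vs.

(** Budget of the last [r] rounds when the current projection has [m] vertices.  A
round costs at most five calls, and seven when the third vertex appears: this is
what the two spare calls are for. *)
Definition loop_cost r m : nat :=
  match size vs with 1 => 2 * r | 2 => 5 * r | _ => 5 * r + 2 * (m < 3) end.

Lemma halted_return S : halted step (Return S).
Proof. by move=> m c st; inversion st. Qed.

Lemma return_within k xs B : (n < k)%N -> projected_vertices vs n xs ->
  terminates_within step three_vertex_result (For k xs) B.
Proof.
move=> nk pv; apply: terminates_within_intro.
  by exists 0%N, (Return [fset x in xs]%fset); apply: StepReturn.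
move=> m c st.
inversion st as [| |? ? kn|? ? kn|? ? ? ? kn| | |? ? ? ? kn|]; subst;
  try by rewrite leqNgt nk in kn.
have vs_xs : vs =i xs.
  apply: reduced_unique => //; first by case: pv.
  have [_ ->] := pv; congr conv_hull.
  by rewrite -[LHS]map_id; apply: eq_map => x; rewrite proj_first_n.
exists B => //; apply: within_final; first exact: halted_return.
by exists [fset x in xs]%fset => // x; rewrite inE vs_xs.
Qed.

Lemma for_within r k xs : (2 < k)%N -> (k + r = n.+1)%N ->
  projected_vertices vs k.-1 xs ->
  terminates_within step three_vertex_result (For k xs) (loop_cost r (size xs)).
Proof.
elim: r k xs => [|r IH] k xs k2 kr pv.
  by apply: return_within; [rewrite -kr addn0|rewrite addn0 in kr; rewrite kr in pv].
have kn : (k <= n)%N by lia.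
have k0 : (0 < k)%N by lia.
have k0n : (0 < k <= n)%N by rewrite k0.
have IH' xs' : projected_vertices vs k xs' ->
    terminates_within step three_vertex_result (For k.+1 xs') (loop_cost r (size xs')).
  by move=> pv'; apply: IH => //; lia.
have /andP[xs_gt0 xs_le] := projected_size vs0 pv.
have costS m m' : (0 < m)%N -> (m <= size vs)%N -> (m <= m')%N ->
    (2 + loop_cost r m' <= loop_cost r.+1 m)%N.
  rewrite /loop_cost => m0 ms mm'; case: (size vs) vs_small ms => [|[|[|[|//]]]] _ ms; lia.
have := lower_upper D_support k; rewrite le_eqVlt => /predU1P[lu|lu].
  apply: terminates_within_intro.
    by exists 2%N, (For k.+1 [seq set_coord k (lower D k) x | x <- xs]); apply: StepFlat.
  move=> m c st.
  inversion st as [| | |? ? _ lt|? ? ? ? _ lt| | |? ? ? ? _ lt|? ? nk]; subst;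
    try by rewrite lu ltxx in lt.
    exists (loop_cost r (size xs)); first exact: costS.
    by rewrite -(size_map (set_coord k (lower D k)) xs); apply/IH'/step_flat.
  by rewrite ltnNge kn in nk.
(* Discards [StepFlat] in the inversions below. *)
have luF : lower D k = upper D k -> False by move=> e; rewrite e ltxx in lu.
case: xs pv xs_gt0 xs_le => [//|x1 [|x2 [|x3 [|x4 xs]]]] pv _ xs_le; last first.
- by have := leq_trans xs_le vs_small.
- have s3 : size [:: x1; x2; x3] = 3 by [].
  apply: terminates_within_intro.
    have [d Hd] : exists d : nat -> 'rV[R]_n * R, forall j, (j < 3)%N ->
        caseIII_direction k (lower D k) (upper D k) [:: x1; x2; x3] j (d j).1 (d j).2.
      have h j : exists d : 'rV[R]_n * R, (j < 3)%N ->
        caseIII_direction k (lower D k) (upper D k) [:: x1; x2; x3] j d.1 d.2.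
        have [j3|j3] := ltnP j 3; last by exists 0.
        have [d [beta h]] := caseIII_direction_exists k0n pv lu s3 j3.
        by exists (d, beta).
      by have [d hd] := choice h; exists d.
    by eexists; eexists; apply: (StepIII (d := fun j => (d j).1) (beta := fun j => (d
        j).2)).
  move=> m c st.
  inversion st as [| |? ? _ e| | | | |? ? d beta _ lt sx dir|? ? nk]; subst => //.
    have vs3 : size vs = 3 by apply/eqP; rewrite eqn_leq vs_small.
    exists (loop_cost r 3); first by rewrite /loop_cost vs3 /=; lia.
    by rewrite -[X in loop_cost _ X](size_mkseq (fun j => set_coord k (lower D k +
      (D (d j) - beta j) * (upper D k - lower D k)) [:: x1; x2; x3]`_j) 3);
      apply/IH'/step_three.
  by rewrite ltnNge kn in nk.
- have [ys [ry /andP[ys0 ys_le] pvy ask_s [ysT t1 t2 t3 t4]]] :=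
    caseII_plane vs0 D_support k0n pv.
  have ask_e := ask_caseII_exists D k0n pv.
  have ys3 := leq_trans ys_le vs_small.
  apply: terminates_within_intro.
    have [p cp pE] := rectangle_enumeration lu.
    by eexists; eexists; apply: (@StepII _ _ _ k x1 x2 p).
  move=> m c st.
  inversion st as [| |? ? _ e| |? ? ? p _ _ cp pE| | |? ? ? ? _ lt sx|? ? nk]; subst =>
      //; last first.
    by rewrite ltnNge kn in nk.
  exists (2 * size ys - 1 + loop_cost r (size ys))%N.
    rewrite /loop_cost /= in xs_le *; case: (size vs) vs_small xs_le ys_le =>
        [|[|[|[|//]]]] _ // _.
      by move: ys0; case: (size ys) => [|[|[|]]]//= _ _; lia.
    by move: ys0; case: (size ys) => [|[|[|[|]]]]//= _ _; lia.
  have := planar_rectangle ry ys3 ask_e ask_s lu cp pE ysT t1 t2 t3 t4.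
  apply: (terminates_within_embed (step' := step) (f := CaseII k x1 x2)).
  + exact: StepIIPlanar.
  + move=> c1 m1 d1 nh st1; inversion st1; subst; first by eexists.
    by case: nh; apply: halted_done.
  + move=> _ _ [S -> Sys].
    have Smap : [seq caseII_point k x1 x2 y | y <- S] =i map (caseII_point k x1 x2) ys.
      exact: eq_mem_map.
    have [[uy _] _] := pvy.
    apply: terminates_within_intro.
      exists 0%N, (For k.+1 (map (caseII_point k x1 x2) ys)).
      by apply: StepIIDone => // y; rewrite Smap.
    move=> m1 d1 st1; inversion st1 as [| | | | |? ? ? ? ? ? st2|? ? ? ? xs' uxs' xs'E|
        |]; subst.
      by inversion st2.
    have e : xs' =i map (caseII_point k x1 x2) ys by move=> y; rewrite xs'E Smap.
    have pv' := eq_projected pvy uxs' e.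
    exists (loop_cost r (size ys)) => //; rewrite -(size_map (caseII_point k x1 x2) ys).
    by rewrite -(perm_size (uniq_perm uxs' uy e)); apply: IH'.
- have pv' := step_point D_support k0n pv lu.
  apply: terminates_within_intro.
    by eexists; eexists; apply: StepI.
  move=> m c st.
  inversion st as [| |? ? _ e|? ? _ lt| | | |? ? ? ? _ lt sx|? ? nk]; subst => //.
    exists (loop_cost r 2) => //; first exact: costS.
    exact: IH'.
  by rewrite ltnNge kn in nk.
Qed.

Lemma program_within : terminates_within step three_vertex_result (Init PInit)
  (match size vs with 1 => 2 * n - 1 | 2 => 5 * n - 3 | _ => 5 * n - 1 end).
Proof.
have [ys [ry /andP[ys0 ys_le] pvy ask_s]] := proj2_plane n_ge2 vs0 D_support.
have ask_e e : exists r, ask_proj2 D e r by exists (D (pad2 n e)).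
have ys3 := leq_trans ys_le vs_small.
have ysn : ys != [::] by case: ys ys0 {ry ys_le pvy ask_s ys3}.
apply: (@terminates_within_leq _ _ _ _
  ((if size ys == 1 then 3 else 3 + 2 * size ys) + loop_cost (n - 2) (size ys))).
  rewrite /loop_cost; case: (size vs) vs_small ys_le => [|[|[|[|//]]]] _.
  - by rewrite leqNgt ys0.
  - by move: ys0; case: (size ys) => [|[|]]//= _ _; lia.
  - by move: ys0; case: (size ys) => [|[|[|]]]//= _ _; lia.
  - by move: ys0; case: (size ys) => [|[|[|[|]]]]//= _ _; lia.
have := planar_triangle ry ys3 ask_e ask_s ysn.
apply: (terminates_within_embed (step' := step) (f := Init)).
- exact: StepInit.
- move=> c1 m1 d1 nh st1; inversion st1; subst; first by eexists.
  by case: nh; apply: halted_done.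
- move=> _ _ [S -> Sys].
  have Smap : [seq pad2 n y | y <- S] =i map (pad2 n) ys by exact: eq_mem_map.
  have [[uy _] _] := pvy.
  apply: terminates_within_intro.
    exists 0%N, (For 3 (map (pad2 n) ys)).
    by apply: StepInitDone => // y; rewrite Smap.
  move=> m1 d1 st1; inversion st1 as [? ? ? st2|? xs' uxs' xs'E| | | | | | |]; subst.
    by inversion st2.
  have e : xs' =i map (pad2 n) ys by move=> y; rewrite xs'E Smap.
  have pv' := eq_projected pvy uxs' e.
  exists (loop_cost (n - 2) (size ys)) => //; rewrite -(size_map (pad2 n) ys).
  by rewrite -(perm_size (uniq_perm uxs' uy e)); apply: for_within => //; lia.
Qed.

End Program.

Theorem theorem4p4 (R : realType) (n : nat) (X : set 'rV[R]_n)
    (D : 'rV[R]_n -> R) (nv : nat) (hn : (2 <= n)%N)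
    (hX : polytope X) (hD : support_oracle X D)
    (hcard : vertices X #= `I_nv) (hnv : (nv <= 3)%N) :
  no_infinite_run (three_vertex_step D) (Init PInit) /\
  forall (calls : nat) (c : conf R n),
    exec (three_vertex_step D) (Init PInit) calls c ->
    halted (three_vertex_step D) c ->
    exists S : {fset 'rV[R]_n},
      [/\ c = Return S,
          vertices X = [set` S],
          nv = 1%N -> (calls <= 2 * n - 1)%N,
          nv = 2%N -> (calls <= 5 * n - 3)%N
        & nv = 3%N -> (calls <= 5 * n - 1)%N].
Proof.
have [s0 s0n XE] := hX; have [vs [rv _ vE]] := reduced_exists s0.
rewrite -vE in XE; have verts : vertices X = [set` vs] by rewrite XE vertices_reduced.
have sv : size vs = nv.
  have : [set` [fset x in vs]%fset] #= `I_nv.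
    rewrite (_ : [set` _] = vertices X)// verts; apply/seteqP.
    by split => x /=; rewrite inE.
  by move/card_eq_fsetP => <-; rewrite card_fseq undup_id//; case: rv.
have supp d : support_value vs d (D d).
  have [[v Xv vD] le] := hD d; rewrite XE in Xv le.
  apply: support_hull; first by exists v; rewrite // dotpC.
  by move=> y /le; rewrite dotpC.
have vs0 : vs != [::].
  have [[v Xv _] _] := hD 0; rewrite XE in Xv; apply/eqP => vs0; rewrite vs0 in Xv.
  by case: Xv => w []; rewrite big_ord0 => _ /eqP; rewrite eq_sym oner_eq0.
have vs3 : (size vs <= 3)%N by rewrite sv.
have T := program_within hn rv vs0 vs3 supp.
split; first exact: terminates_within_acc T.
move=> calls c e hc; have [[S -> SE] le] := terminates_within_exec T e hc.
exists S; split => //.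
- by rewrite verts; apply/seteqP; split => x /=; rewrite SE.
- by move=> h; move: le; rewrite sv h.
- by move=> h; move: le; rewrite sv h.
- by move=> h; move: le; rewrite sv h.
Qed.
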